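(* Let $k\ge 4$ and let $q_k$ be the pattern $1\,2\cdots(k-3)\,(k-1)\,k\,(k-2)$ (so $q_4=1342$, $q_5=12453$, etc.). Then $L(q_k)=(k-4+\sqrt{8})^2$.
   Context: A permutation $p=p_1\cdots p_n$ of $[n]$ contains a pattern $q=q_1\cdots q_k$ (a permutation of $[k]$) if there are indices $i_1<\dots<i_k$ with $p_{i_a}<p_{i_b}$ iff $q_a<q_b$; otherwise $p$ avoids $q$. $S_n(q)$ is the number of permutations of length $n$ avoiding $q$, and $L(q)=\lim_{n\to\infty}\sqrt[n]{S_n(q)}$ (this limit is known to exist for every pattern $q$). *)

(* Defs.v *)
From mathcomp Require Import all_boot all_order all_algebra all_fingroup.
From mathcomp Require Import all_classical all_reals all_analysis.
From mathcomp Require Import zify.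

Set Implicit Arguments.
Unset Strict Implicit.
Unset Printing Implicit Defensive.

Import Order.TTheory GRing.Theory Num.Theory.
Import numFieldNormedType.Exports.

(* A permutation of [n] is an element of 'S_n, with positions and values both
   shifted down by one: p_i = (p (i - 1)).+1. *)

Definition contains (n k : nat) (p : 'S_n) (q : 'S_k) : bool :=
  [exists f : {ffun 'I_k -> 'I_n},
    [forall a : 'I_k, forall b : 'I_k, (a < b)%N ==> (f a < f b)%N]
    && [forall a : 'I_k, forall b : 'I_k,
          (p (f a) < p (f b))%N == (q a < q b)%N]].

Definition avoids (n k : nat) (p : 'S_n) (q : 'S_k) : bool := ~~ contains p q.

Definition num_avoiders (k : nat) (q : 'S_k) (n : nat) : nat :=
  #|[set p : 'S_n | avoids p q]|.

(* The term at n = 0 is a power with exponent 0^-1 = 0; it does not affect the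
   limit. *)
Definition avoiders_root (R : realType) (k : nat) (q : 'S_k) : nat -> R :=
  fun n => powR (num_avoiders q n)%:R (n%:R^-1)%R.

(* Meaningful only together with [cvgn (avoiders_root R q)]. *)
Definition growth_rate (R : realType) (k : nat) (q : 'S_k) : R :=
  limn (avoiders_root R q).

(* Zero-based values of 1 2 ... (k-3) (k-1) k (k-2); this is a permutation for
   every k, and [pattern_q_word] gives its one-line notation when k >= 3. *)
Definition pattern_q_val (k i : nat) : nat :=
  if (i < k - 3)%N then i else if i == k.-1 then (k - 3)%N else i.+1.

Lemma pattern_q_val_lt (k : nat) (i : 'I_k) : (pattern_q_val k i < k)%N.
Proof.
rewrite /pattern_q_val; have := ltn_ord i.
by case: ifP => ?; [|case: ifP => ?]; lia.
Qed.

Definition pattern_q_fun (k : nat) (i : 'I_k) : 'I_k :=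
  Ordinal (pattern_q_val_lt i).

Lemma pattern_q_fun_inj (k : nat) : injective (@pattern_q_fun k).
Proof.
move=> i j /(congr1 val) /= eq_ij; apply: val_inj => /=.
move: eq_ij (ltn_ord i) (ltn_ord j); rewrite /pattern_q_val.
by do 2![case: ifP => ?; [|case: ifP => ?]]; lia.
Qed.

Definition pattern_q (k : nat) : 'S_k := perm (@pattern_q_fun_inj k).

Lemma pattern_q_word (k : nat) : (3 <= k)%N ->
  [seq (val (pattern_q k i)).+1 | i <- enum 'I_k]
  = iota 1 (k - 3) ++ [:: k - 1; k; k - 2]%N.
Proof.
move=> k_ge3.
have -> : [seq (val (pattern_q k i)).+1 | i <- enum 'I_k]
          = [seq (pattern_q_val k i).+1 | i <- iota 0 k].
  by rewrite -val_enum_ord -map_comp; apply: eq_map => i /=; rewrite permE.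
have {1}-> : iota 0 k = iota 0 (k - 3) ++ iota (k - 3) 3.
  by rewrite -iotaD subnK.
rewrite map_cat; congr (_ ++ _).
  rewrite (iotaDl 1 0); apply/eq_in_map => i.
  by rewrite mem_iota /pattern_q_val add0n => /andP[_ ->].
rewrite /pattern_q_val /=.
by congr [:: _; _; _]; case: ifP => ?; try (case: ifP => ?); lia.
Qed.

(* Main.v *)
From HB Require Import structures.
Require Import Defs.
From mathcomp Require Import all_boot all_order all_algebra all_fingroup.
From mathcomp Require Import all_classical all_reals all_analysis.
From mathcomp Require Import zify ring lra.

(** Write [1 (+) q] for [q] with a new minimum put in front, so that
    [q_4 = 1 (+) 231] and [q_(k+1) = 1 (+) q_k].

    If [q] starts with its minimum, a permutation avoids [1 (+) q] iff its entries
    that are not left-to-right minima avoid [q]; recording the positions and the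
    values of the minima gives [S_n(1 (+) q) <= sum_i C(n,i)^2 S_(n-i)(q)].
    Conversely, a [q]-avoider of length [l] can be put above and to the left of a
    [1 (+) q]-avoider whose [l] top entries avoid [q], with a decreasing sequence of
    length [i] whose positions are shuffled with the former and whose values are
    shuffled with the [l] top entries of the latter, in [C(l+i,i)^2] ways.  Both
    bounds turn the growth rate [y^2] into [(1 + y)^2].

    For 1342, build permutations by inserting entries in front.  The entry [a] may
    be inserted iff the entries above [a] avoid 231, and the future of a permutation
    depends only on which of the active levels are crossed by no inversion; this is
    a walk on stacks of positive integers.  Cutting the walks at the last change of
    the bottom of the stack gives, with [A = P(1)],
    [x u^2 P^2 + A (1 - u - x u) P = A (1 - u)], where [A] is the generating function
    of [S_n(1342)].  Its solution is parametrised by [x = z (1 - 2 z)], with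
    [A = (1 - 2 z) / (1 - z)^3], hence [A ((1 - 8 x) z + 7 x - 2 x^2) = 8 x], a
    renewal equation whose weights grow like [8^n n^(-5/2)]. *)

Set Implicit Arguments.
Unset Strict Implicit.
Unset Printing Implicit Defensive.

Import Order.TTheory GRing.Theory Num.Theory.
Import numFieldNormedType.Exports.

Local Open Scope ring_scope.

(** * Formal power series *)

(** The record keeps the Cauchy product apart from pointwise operations on functions. *)
Record fps (R : comNzRingType) := Fps { coef : nat -> R }.

HB.instance Definition _ (R : comNzRingType) := gen_eqMixin (fps R).
HB.instance Definition _ (R : comNzRingType) := gen_choiceMixin (fps R).

Lemma fpsP (R : comNzRingType) (f g : fps R) :
  (forall n, coef f n = coef g n) -> f = g.
Proof. by case: f g => f [g] /= fg; congr Fps; exact/funext. Qed.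

Definition fps_zero (R : comNzRingType) : fps R := Fps (fun=> 0).
Definition fps_const (R : comNzRingType) (a : R) : fps R :=
  Fps (fun n => if n is 0 then a else 0).
Definition fps_opp (R : comNzRingType) (f : fps R) := Fps (fun n => - coef f n).
Definition fps_add (R : comNzRingType) (f g : fps R) :=
  Fps (fun n => coef f n + coef g n).
Definition fps_mul (R : comNzRingType) (f g : fps R) :=
  Fps (fun n => \sum_(i < n.+1) coef f i * coef g (n - i)).

(** Low coefficients of a product depend only on truncations, so commutativity, associativity and
    the Leibniz rule can be taken from [{poly R}]. *)
Definition fps_trunc (R : comNzRingType) (N : nat) (f : fps R) : {poly R} :=
  \poly_(i < N) coef f i.

Lemma coef_fps_trunc (R : comNzRingType) (N : nat) (f : fps R) (i : nat) :
  (i < N)%N -> (fps_trunc N f)`_i = coef f i.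
Proof. by move=> iN; rewrite coef_poly iN. Qed.

Lemma coef_fps_mul (R : comNzRingType) (N : nat) (f g : fps R) (n : nat) :
  (n < N)%N ->
  coef (fps_mul f g) n = (fps_trunc N f * fps_trunc N g)`_n.
Proof.
move=> nN; rewrite coefM /=; apply: eq_bigr => i _.
by rewrite !coef_fps_trunc //; have := ltn_ord i; lia.
Qed.

Lemma fps_addA (R : comNzRingType) : associative (@fps_add R).
Proof. by move=> f g h; apply: fpsP => n; exact: addrA. Qed.
Lemma fps_addC (R : comNzRingType) : commutative (@fps_add R).
Proof. by move=> f g; apply: fpsP => n; exact: addrC. Qed.
Lemma fps_add0 (R : comNzRingType) : left_id (fps_zero R) (@fps_add R).
Proof. by move=> f; apply: fpsP => n; exact: add0r. Qed.
Lemma fps_addN (R : comNzRingType) :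
  left_inverse (fps_zero R) (@fps_opp R) (@fps_add R).
Proof. by move=> f; apply: fpsP => n; exact: addNr. Qed.

HB.instance Definition _ (R : comNzRingType) :=
  GRing.isZmodule.Build (fps R)
    (@fps_addA R) (@fps_addC R) (@fps_add0 R) (@fps_addN R).

Lemma fps_mulC (R : comNzRingType) : commutative (@fps_mul R).
Proof.
move=> f g; apply: fpsP => n.
by rewrite !(@coef_fps_mul _ n.+1) // mulrC.
Qed.

Lemma fps_mulA (R : comNzRingType) : associative (@fps_mul R).
Proof.
have assocl (f g h : fps R) n : coef (fps_mul (fps_mul f g) h) n =
    (fps_trunc n.+1 f * fps_trunc n.+1 g * fps_trunc n.+1 h)`_n.
  rewrite [in RHS]coefM /=; apply: eq_bigr => i _.
  by rewrite -(@coef_fps_mul _ n.+1) ?coef_fps_trunc //; lia.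
move=> f g h; apply: fpsP => n.
rewrite assocl fps_mulC assocl; congr (_ `_ n).
by rewrite mulrC mulrA.
Qed.

Lemma fps_mul1 (R : comNzRingType) : left_id (fps_const 1) (@fps_mul R).
Proof.
move=> f; apply: fpsP => n /=.
rewrite big_ord_recl /= subn0 mul1r big1 ?addr0 // => i _.
by rewrite mul0r.
Qed.

Lemma fps_mulDl (R : comNzRingType) : left_distributive (@fps_mul R) (@fps_add R).
Proof.
move=> f g h; apply: fpsP => n /=; rewrite -big_split /=.
by apply: eq_bigr => i _; rewrite mulrDl.
Qed.

Lemma fps_one_neq0 (R : comNzRingType) : fps_const (1 : R) != 0.
Proof. by apply/eqP => /(congr1 (@coef R ^~ 0%N)) /eqP; rewrite oner_eq0. Qed.

HB.instance Definition _ (R : comNzRingType) :=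
  GRing.Zmodule_isComNzRing.Build (fps R)
    (@fps_mulA R) (@fps_mulC R) (@fps_mul1 R) (@fps_mulDl R) (@fps_one_neq0 R).

Lemma coefD_fps (R : comNzRingType) (f g : fps R) n :
  coef (f + g) n = coef f n + coef g n.
Proof. by []. Qed.
Lemma coefN_fps (R : comNzRingType) (f : fps R) n : coef (- f) n = - coef f n.
Proof. by []. Qed.
Lemma coefB_fps (R : comNzRingType) (f g : fps R) n :
  coef (f - g) n = coef f n - coef g n.
Proof. by []. Qed.
Lemma coefM_fps (R : comNzRingType) (f g : fps R) n :
  coef (f * g) n = \sum_(i < n.+1) coef f i * coef g (n - i).
Proof. by []. Qed.
Lemma coef0_fps (R : comNzRingType) n : coef (0 : fps R) n = 0.
Proof. by []. Qed.
Lemma coef1_fps (R : comNzRingType) n : coef (1 : fps R) n = (n == 0)%:R.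
Proof. by case: n. Qed.
Lemma coefMn_fps (R : comNzRingType) (f : fps R) k n :
  coef (f *+ k) n = coef f n *+ k.
Proof. by elim: k => [|k IHk]; rewrite ?mulr0n // !mulrS coefD_fps IHk. Qed.
Lemma coef_nat_fps (R : comNzRingType) (k : nat) (f : fps R) n :
  coef (k%:R * f) n = k%:R * coef f n.
Proof. by rewrite !mulr_natl coefMn_fps. Qed.

Lemma coef_constM (R : comNzRingType) (a : R) (f : fps R) n :
  coef (fps_const a * f) n = a * coef f n.
Proof.
rewrite coefM_fps big_ord_recl /= subn0 big1 ?addr0 // => i _.
by rewrite mul0r.
Qed.

Definition fps_X (R : comNzRingType) : fps R := Fps (fun n => (n == 1%N)%:R).

Lemma coef_XM (R : comNzRingType) (f : fps R) n :
  coef (fps_X R * f) n = if n is m.+1 then coef f m else 0.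
Proof.
rewrite coefM_fps; case: n => [|n]; first by rewrite big_ord1 mul0r.
rewrite big_ord_recl mul0r add0r big_ord_recl /= mul1r subSS subn0.
by rewrite big1 ?addr0 // => i _; rewrite mul0r.
Qed.

Definition fps_map (R : comNzRingType) (h : {rmorphism R -> R}) (f : fps R) :=
  Fps (fun n => h (coef f n)).

Lemma fps_mapD (R : comNzRingType) (h : {rmorphism R -> R}) (f g : fps R) :
  fps_map h (f + g) = fps_map h f + fps_map h g.
Proof. by apply: fpsP => n; exact: rmorphD. Qed.
Lemma fps_mapB (R : comNzRingType) (h : {rmorphism R -> R}) (f g : fps R) :
  fps_map h (f - g) = fps_map h f - fps_map h g.
Proof. by apply: fpsP => n; exact: rmorphB. Qed.
Lemma fps_map1 (R : comNzRingType) (h : {rmorphism R -> R}) : fps_map h 1 = 1.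
Proof. by apply: fpsP => -[|n] /=; rewrite ?rmorph1 ?rmorph0. Qed.
Lemma fps_mapX (R : comNzRingType) (h : {rmorphism R -> R}) :
  fps_map h (fps_X R) = fps_X R.
Proof. by apply: fpsP => n /=; rewrite rmorph_nat. Qed.
Lemma fps_mapM (R : comNzRingType) (h : {rmorphism R -> R}) (f g : fps R) :
  fps_map h (f * g) = fps_map h f * fps_map h g.
Proof.
apply: fpsP => n; rewrite /= rmorph_sum; apply: eq_bigr => i _.
exact: rmorphM.
Qed.

Definition fps_deriv (R : comNzRingType) (f : fps R) : fps R :=
  Fps (fun n => coef f n.+1 *+ n.+1).

Lemma fps_derivM (R : comNzRingType) (f g : fps R) :
  fps_deriv (f * g) = fps_deriv f * g + f * fps_deriv g.
Proof.
(* One more coefficient is kept, since differentiation lowers degrees by one. *)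
have tr (e : fps R) n : (fps_trunc n.+1 (fps_deriv e)) = (fps_trunc n.+2 e)^`().
  apply/polyP => i; rewrite coef_deriv !coef_poly !ltnS.
  by case: leqP; rewrite ?mul0rn.
apply: fpsP => n.
have -> : coef (fps_deriv (f * g)) n =
    (fps_trunc n.+2 f * fps_trunc n.+2 g)`_n.+1 *+ n.+1.
  by rewrite -coef_fps_mul.
rewrite -coef_deriv derivM coefD -!tr coefD_fps.
by congr (_ + _); rewrite coefM coefM_fps; apply: eq_bigr => i _;
  rewrite !coef_fps_trunc //; have := ltn_ord i; lia.
Qed.

(** * Fixed points of contractive maps on power series *)

Definition eq_below (R : comNzRingType) (n : nat) (f g : fps R) :=
  forall k, (k < n)%N -> coef f k = coef g k.

(** Contraction for the [x]-adic metric: a recursive equation of this kind has exactly one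
    solution. *)
Definition contractive (R : comNzRingType) (F : fps R -> fps R) :=
  forall n f g, eq_below n f g -> eq_below n.+1 (F f) (F g).

Lemma contractive_uniq (R : comNzRingType) (F : fps R -> fps R) (f g : fps R) :
  contractive F -> F f = f -> F g = g -> f = g.
Proof.
move=> Fc Ff Fg; have fg : forall n, eq_below n f g.
  by elim=> [|n IHn]; [move=> k|rewrite -Ff -Fg; exact: Fc].
by apply: fpsP => n; exact: (fg n.+1).
Qed.

Lemma contractive_fixpoint (R : comNzRingType) (F : fps R -> fps R) :
  contractive F -> exists f, F f = f.
Proof.
move=> Fc; pose it n := iter n F 0.
have step n : eq_below n (it n) (it n.+1).
  by elim: n => [|n IHn]; [move=> k|exact: Fc IHn].
have stab n m : (n <= m)%N -> eq_below n (it n) (it m).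
  move=> /subnK <-; elim: (m - n)%N => [//|d IHd] k kn.
  by rewrite IHd // addSn; apply: step; lia.
(* Coefficient [n] no longer changes from iterate [n + 1] on, so the diagonal is the limit. *)
exists (Fps (fun n => coef (it n.+1) n)); apply: fpsP => n.
rewrite (Fc n _ (it n)) //= => k kn /=.
exact: (stab k.+1 n).
Qed.

Lemma eq_belowM (R : comNzRingType) n (t f g : fps R) :
  coef t 0 = 0 -> eq_below n f g -> eq_below n.+1 (t * f) (t * g).
Proof.
move=> t0 fg k kn; rewrite !coefM_fps !big_ord_recl /= t0 !mul0r; congr (_ + _).
apply: eq_bigr => i _; congr (_ * _); apply: fg.
by rewrite /bump /=; have := ltn_ord i; lia.
Qed.

Lemma eq_below_sqr (R : comNzRingType) n (f g : fps R) :
  eq_below n f g -> eq_below n (f * f) (g * g).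
Proof.
move=> fg k kn; rewrite !coefM_fps; apply: eq_bigr => i _.
by rewrite !fg //; have := ltn_ord i; lia.
Qed.

Lemma contractive_quadratic (R : comNzRingType) (t : fps R) :
  coef t 0 = 0 -> contractive (fun f => 1 + t * (f * f)).
Proof.
by move=> t0 n f g /eq_below_sqr/(eq_belowM t0) fg k kn; rewrite !coefD_fps fg.
Qed.

Lemma contractive_affine (R : comNzRingType) (t : fps R) :
  coef t 0 = 0 -> contractive (fun f => 1 + t * f).
Proof. by move=> t0 n f g /(eq_belowM t0) fg k kn; rewrite !coefD_fps fg. Qed.

(** * The catalytic equation *)

Lemma coefM_below (R : comNzRingType) n (g f : fps R) :
  eq_below n f 0 -> eq_below n (g * f) 0 /\ coef (g * f) n = coef g 0 * coef f n.
Proof.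
move=> f0; split=> [k kn|].
  rewrite coefM_fps big1 // => i _; rewrite f0 ?coef0_fps ?mulr0 //.
  by have := ltn_ord i; lia.
rewrite coefM_fps big_ord_recl /= subn0 big1 ?addr0 // => i _.
by rewrite f0 ?coef0_fps ?mulr0 // /bump /=; have := ltn_ord i; lia.
Qed.

(** In [fps {poly R}] the series variable is [x], marking length, and the polynomial variable is the
    catalytic variable [u]. *)
Definition fps_U (R : comNzRingType) : fps {poly R} := fps_const 'X.

(** Substitutes [u = 1] and embeds the value back as a constant, so that [P] and [A = P(1)] live in
    the same ring. *)
Definition eval1 (R : comNzRingType) : {rmorphism {poly R} -> {poly R}} :=
  polyC \o horner_eval (1 : R).

Definition fps_eval1 (R : comNzRingType) (f : fps {poly R}) : fps {poly R} :=
  fps_map (eval1 R) f.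

Lemma coef_fps_eval1 (R : comNzRingType) (f : fps {poly R}) n :
  coef (fps_eval1 f) n = (coef f n).[1]%:P.
Proof. by []. Qed.

Lemma fps_eval1U (R : comNzRingType) : fps_eval1 (fps_U R) = 1.
Proof.
by apply: fpsP => -[|n] /=; rewrite /horner_eval ?hornerX ?horner0 ?polyC1 ?polyC0.
Qed.

Definition catalytic_eq (R : comNzRingType) (P : fps {poly R}) :=
  let A := fps_eval1 P in let X := fps_X {poly R} in let U := fps_U R in
  X * U ^+ 2 * P ^+ 2 + A * (1 - U - X * U) * P = A * (1 - U).

(** Subtracting the two equations gives a linear relation between [D = P - Q] and [E = A - B]. If
    both vanish below order [n], its coefficient of order [n] reads [(1 - u) D_n = 0]: the part with
    factor [X] is of higher order, and [E_n] is multiplied by the zero constant term of [Q - 1]. *)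
Lemma catalytic_uniq (R : idomainType) (P Q : fps {poly R}) :
  coef P 0 = 1 -> coef Q 0 = 1 -> catalytic_eq P -> catalytic_eq Q -> P = Q.
Proof.
move=> P0 Q0; rewrite /catalytic_eq /=.
set A := fps_eval1 P; set B := fps_eval1 Q; set X := fps_X _; set U := fps_U R.
move=> hP hQ; pose D := P - Q; pose E := A - B.
have ED : E = fps_eval1 D by rewrite /fps_eval1 fps_mapB.
have A0 : coef A 0 = 1 by rewrite coef_fps_eval1 P0 hornerC polyC1.
have key : X * (U ^+ 2 * (P + Q) * D - U * A * D - U * Q * E)
    + (1 - U) * (A * D + (Q - 1) * E) = 0.
  suff -> : X * (U ^+ 2 * (P + Q) * D - U * A * D - U * Q * E)
      + (1 - U) * (A * D + (Q - 1) * E) =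
    (X * U ^+ 2 * P ^+ 2 + A * (1 - U - X * U) * P - A * (1 - U)) -
    (X * U ^+ 2 * Q ^+ 2 + B * (1 - U - X * U) * Q - B * (1 - U)).
    by rewrite hP hQ !subrr.
  by rewrite /D /E; ring.
suff D0 n : eq_below n D 0.
  by apply: fpsP => n; apply/eqP; rewrite -subr_eq0 -coefB_fps (D0 n.+1).
elim: n => [//|n IHn] k; rewrite ltnS leq_eqVlt => /orP[/eqP ->{k}|]; last exact: IHn.
have En : eq_below n E 0.
  by move=> k kn; rewrite ED coef_fps_eval1 IHn // horner0 polyC0.
have {key} := congr1 (@coef _ ^~ n) key.
have -> : 1 - U = fps_const (1 - 'X).
  by apply: fpsP => -[|m]; rewrite coefB_fps coef1_fps /U /= ?subr0.
rewrite coefD_fps coef_constM coef_XM coefD_fps.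
have [_ ->] := coefM_below A IHn; have [_ ->] := coefM_below (Q - 1) En.
rewrite A0 mul1r (coefB_fps Q) Q0 coef1_fps subrr mul0r addr0.
set rest := (X in X + _); have -> : rest = 0.
  rewrite /rest; case: {+}n IHn En => // m IHm Em.
  rewrite !coefB_fps (coefM_below _ IHm).1 // (coefM_below (U * A) IHm).1 //.
  by rewrite (coefM_below _ Em).1 // !coef0_fps !subr0.
rewrite add0r => /eqP; rewrite mulf_eq0 => /orP[|/eqP->//].
rewrite subr_eq0 => /eqP /(congr1 (fun p : {poly R} => p`_1)) /eqP.
by rewrite coefX coefC /= eq_sym oner_eq0.
Qed.

(** An explicit solution [Q] is built from fixed points, checked against the equation, and
    identified with [P] by [catalytic_uniq]. *)
Lemma catalytic_solution (R : idomainType) (P : fps {poly R}) :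
  coef P 0 = 1 -> catalytic_eq P ->
  let A := fps_eval1 P in let X := fps_X {poly R} in
  exists z, [/\ coef z 0 = 0, z = X + 2 * z ^+ 2 &
    A * ((1 - 8 * X) * z + 7 * X - 2 * X ^+ 2) = 8 * X].
Proof.
move=> P0 hP A X; pose U := fps_U R.
have X0 (f : fps {poly R}) : coef (X * f) 0 = 0 by rewrite coef_XM.
have two : coef (2 * X) 0 = 0 by rewrite mulrC X0.
(* Dividing [z = x + 2 z^2] by [x] with [z = x c] gives the contractive equation
   [c = 1 + 2 x c^2]. *)
have evc := contractive_quadratic two.
have [c cE] := contractive_fixpoint evc.
have Ec : fps_eval1 c = c.
  apply: (contractive_uniq evc _ cE); rewrite -{3}cE /fps_eval1.
  have map2 : fps_map (eval1 R) 2%:R = 2%:R.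
    by rewrite -[2%:R]/(1 + 1) fps_mapD fps_map1.
  by rewrite fps_mapD fps_map1 !fps_mapM map2 fps_mapX.
pose z := X * c.
have zE : z = X + 2 * z ^+ 2 by rewrite {1}/z -{1}cE /z; ring.
have z0 : coef z 0 = 0 by rewrite X0.
have Ez : fps_eval1 z = z by rewrite /fps_eval1 fps_mapM fps_mapX -/(fps_eval1 c) Ec.
have coefM0 (f h : fps {poly R}) : coef (f * h) 0 = coef f 0 * coef h 0.
  by rewrite coefM_fps big_ord1.
clearbody z; have [g gE] := contractive_fixpoint (contractive_affine z0).
have g1 : (1 - z) * g = 1 by rewrite mulrBl mul1r -{1}gE addrK.
have Eg : fps_eval1 g = g.
  apply: (contractive_uniq (contractive_affine z0) (f := fps_eval1 g) _ gE).
  transitivity (1 + fps_eval1 z * fps_eval1 g); first by rewrite Ez.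
  by rewrite -{2}gE /fps_eval1 fps_mapD fps_map1 (fps_mapM (eval1 R) z).
(* [C] below is the Catalan series at [t]; at [u = 1] its equation is solved by
   [g = 1 / (1 - z)]. *)
pose t := z * (1 - z) * U.
have t0 : coef t 0 = 0 by rewrite /t -mulrA coefM0 z0 mul0r.
have [C CE] := contractive_fixpoint (contractive_quadratic t0).
have EC : fps_eval1 C = g.
  have zz0 : coef (z * (1 - z)) 0 = 0 by rewrite coefM0 z0 mul0r.
  apply: (contractive_uniq (contractive_quadratic zz0)).
    rewrite -[in RHS]CE /fps_eval1 fps_mapD fps_map1 !fps_mapM fps_mapB fps_map1.
    by rewrite -/(fps_eval1 z) Ez -/(fps_eval1 (fps_U R)) fps_eval1U; ring.
  by rewrite -[in RHS]gE; transitivity (1 + z * ((1 - z) * g) * g);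
    [ring|rewrite g1; ring].
(* The closed form of the solution; at [u = 1] it becomes [(1 - 2 z) / (1 - z)^3]. *)
pose Q := g * (C - z * C ^+ 2).
have EQ : fps_eval1 Q = g ^+ 3 * (1 - 2 * z).
  have -> : fps_eval1 Q = g * (g - z * g ^+ 2).
    by rewrite /fps_eval1 fps_mapM fps_mapB !fps_mapM
      -!/(fps_eval1 _) Ez Eg EC.
  transitivity (g ^+ 2 * ((1 - z) * g) - z * g ^+ 3); last by ring.
  by rewrite g1; ring.
have C0 : coef C 0 = 1 by rewrite -CE coefD_fps coefM0 t0 mul0r addr0.
have g0 : coef g 0 = 1 by rewrite -gE coefD_fps coefM0 z0 mul0r addr0.
have Q0 : coef Q 0 = 1.
  by rewrite coefM0 coefB_fps (coefM0 z) z0 mul0r subr0 C0 g0 mulr1.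
have XE : X = z - 2 * z ^+ 2 by rewrite {1}zE addrK.
have CE' : C = 1 + z * (1 - z) * U * C ^+ 2 by rewrite -{1}CE /t; ring.
have hQ : catalytic_eq Q.
  rewrite /catalytic_eq EQ -/X -/U XE.
  pose v := (1 - z) * U; pose w := C - z * C ^+ 2.
  (* [q] is the cofactor of the quadratic relation of [C] in the equation to be proved. *)
  pose q := z ^+ 2 * v * C ^+ 2 + z * (1 - 2 * v) * C + (v + z - 1).
  have bracket : z * (1 - z) ^+ 2 * U ^+ 2 * w ^+ 2
      + (1 - U - (z - 2 * z ^+ 2) * U) * w = (1 - z) * (1 - U).
    apply/eqP; rewrite -subr_eq0; apply/eqP.
    transitivity (q * (z * (1 - z) * U * C ^+ 2 - C + 1)).
      by rewrite /q /w /v; ring.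
    suff -> : z * (1 - z) * U * C ^+ 2 - C + 1 = 0 by rewrite mulr0.
    by rewrite [X in _ - X]CE'; ring.
  transitivity ((1 - 2 * z) * g ^+ 4 * (z * (1 - z) ^+ 2 * U ^+ 2 * w ^+ 2
      + (1 - U - (z - 2 * z ^+ 2) * U) * w)
    + z * (1 - 2 * z) * U ^+ 2 * g ^+ 2 * w ^+ 2
      * (1 - ((1 - z) * g) ^+ 2)).
    by rewrite /Q -/w; ring.
  rewrite g1 bracket.
  transitivity ((1 - 2 * z) * (1 - U) * g ^+ 3 * ((1 - z) * g)); first by ring.
  by rewrite g1; ring.
have -> : A = g ^+ 3 * (1 - 2 * z).
  by rewrite -EQ /A (catalytic_uniq P0 Q0 hP hQ).
exists z; split=> //; rewrite XE.
(* With [x = z (1 - 2 z)], the factor [(1 - 8 x) z + 7 x - 2 x^2] equals [8 z (1 - z)^3]. *)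
transitivity (8 * z * (1 - 2 * z) * ((1 - z) * g) ^+ 3); first ring.
by rewrite g1; ring.
Qed.

(* The coefficients [2^(n-1) Cat_(n-1)] of the solution of [z = x + 2 z^2]. *)
Definition catalan8 (R : realFieldType) (z : nat -> R) :=
  z 1%N = 1 /\
  forall n, (0 < n)%N -> n.+1%:R * z n.+1 = (8 * n%:R - 4) * z n.

Lemma catalan8_ge0 (R : realFieldType) (z : nat -> R) n :
  catalan8 z -> 0 <= z n.+1.
Proof.
move=> [z1 zS]; elim: n => [|n IHn]; first by rewrite z1.
have /(congr1 (fun t => t / n.+2%:R)) := zS n.+1 isT.
rewrite mulrAC mulfV ?pnatr_eq0 // mul1r => ->.
by rewrite divr_ge0 // mulr_ge0 //; rewrite -natr1; have := ler0n R n; lra.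
Qed.

(** With [x = n + 1], [a = z (n + 1)] and [b = z (n + 2)], the recursion gives
    [(x + 1)^2 b = 8 x^2 a + 4 (x - 1) a], and the last term is nonnegative. *)
Lemma catalan8_low (R : realFieldType) (z : nat -> R) n :
  catalan8 z -> 8 ^+ n <= n.+1%:R ^+ 2 * z n.+1.
Proof.
move=> zP; elim: n => [|n IHn]; first by rewrite zP.1 expr1n mulr1.
have := zP.2 n.+1 isT; have := catalan8_ge0 n zP; have := catalan8_ge0 n.+1 zP.
rewrite exprS -(natr1 n.+1).
move: (8 ^+ n) IHn => e; set x : R := n.+1%:R => IHn.
have x1 : 1 <= x by rewrite ler1n.
move: (z n.+1) (z n.+2) IHn => a b IHn b0 a0 rec.
have : (x + 1) ^+ 2 * b = (x + 1) * ((8 * x - 4) * a) by rewrite -rec; ring.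
move=> ->; have : 0 <= a * (x - 1) by rewrite mulr_ge0 // subr_ge0.
move: x a e IHn {x1 rec b b0 a0} => x a e; rewrite expr2.
have -> : (x + 1) * ((8 * x - 4) * a) = 8 * (x * x * a) + 4 * (a * (x - 1)).
  by ring.
move: (x * x * a) (a * _) => p q; lra.
Qed.

(** * Weights and bounds for the renewal equation *)

(** By the recursion, [(n + 2) (8 z (n + 1) - z (n + 2))] is exactly [12 z (n + 1)]; the correction
    at [n = 0] only adds to it. In particular the weights are nonnegative. *)
Lemma renewal_weight (R : realFieldType) (z : nat -> R) n :
  catalan8 z ->
  12 * z n.+1 <= n.+2%:R * (8 * z n.+1 - z n.+2 + 2 *+ (n == 0)%N).
Proof.
move=> zP; rewrite mulrDr mulrBr zP.2 // -(natr1 n.+1).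
have : 0 <= (n.+1%:R + 1) * (2 *+ (n == 0)%N) :> R by rewrite mulr_ge0 // mulrn_wge0.
move: (2 *+ _) => e; set x : R := n.+1%:R; move: (z n.+1) => a e0.
have -> : 12 * a = (x + 1) * (8 * a) - (8 * x - 4) * a by ring.
by rewrite lerDl.
Qed.

Lemma renewal_telescope (R : realFieldType) (z : nat -> R) n m :
  catalan8 z -> (m <= n)%N ->
  \sum_(i < m) 8 ^+ (n - i.+1) * (8 * z i.+1 - z i.+2 + 2 *+ (i == 0 :> nat)%N)
    = 8 ^+ n - 8 ^+ (n - m) * z m.+1 + (2 * 8 ^+ n.-1) *+ (0 < m)%N.
Proof.
move=> zP; elim: m => [|m IHm] mn.
  by rewrite big_ord0 subn0 zP.1 mulr1 subrr addr0.
rewrite big_ord_recr /= (IHm (ltnW mn)).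
have -> : (n - m = (n - m.+1).+1)%N by lia.
rewrite exprS; case: m mn {IHm} => [|m] mn /=.
  by rewrite subn1 mulr0n mulr1n; move: (8 ^+ n) (8 ^+ n.-1) => p q; ring.
rewrite mulr0n mulr1n.
by move: (8 ^+ n) (8 ^+ n.-1) (8 ^+ (n - m.+2)) => p q r; ring.
Qed.

(** If [S i <= 8^i] for all [i < n], the telescoping sum bounds [8 S n] by [8^n + 2 8^(n-1)], which
    closes the induction. For the lower bound the term [i = 0] suffices, its weight being at least
    [12 z n / (n + 1)]. *)
Lemma renewal_bounds (R : realFieldType) (S z : nat -> R) :
  S 0%N = 1 -> (forall n, 0 <= S n) -> catalan8 z ->
  (forall n, (0 < n)%N -> 8 * S n = \sum_(i < n) S i *
     (8 * z (n - i)%N - z (n - i).+1 + 2 *+ (n - i == 1)%N)) ->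
  forall n, S n <= 8 ^+ n /\ 8 ^+ n <= 64 * n.+1%:R ^+ 3 * S n.
Proof.
move=> S0 Sge0 zP SE.
pose w n : R := 8 * z n.+1 - z n.+2 + 2 *+ (n == 0)%N.
have w_ge0 n : 0 <= w n.
  have := renewal_weight n zP; have := catalan8_ge0 n zP; rewrite -/(w n) => ? ?.
  have : 0 <= n.+2%:R * w n by lra.
  by rewrite pmulr_rge0 // ltr0n.
have SwE n : (0 < n)%N -> 8 * S n = \sum_(i < n) S i * w (n - i.+1)%N.
  move=> n0; rewrite SE //; apply: eq_bigr => i _.
  by rewrite /w subnS; have := ltn_ord i; rewrite -subn_gt0; case: (n - i)%N.
have upper n : S n <= 8 ^+ n.
  elim/ltn_ind: n => -[|n] IHn; first by rewrite S0.
  have : 8 * S n.+1 <= \sum_(i < n.+1) 8 ^+ (n.+1 - i.+1) * w i.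
    rewrite SwE // [leRHS](reindex_inj rev_ord_inj) /=; apply: ler_sum => i _.
    have -> : (n.+1 - (n.+1 - i.+1).+1 = i)%N by have := ltn_ord i; lia.
    by rewrite ler_wpM2r ?IHn.
  rewrite renewal_telescope // subnn expr0 mul1r /= mulr1n exprS.
  have := catalan8_ge0 n.+1 zP; have : 0 <= 8 ^+ n :> R by rewrite exprn_ge0.
  by move: (8 ^+ n) (z _) (S _) => a b c; lra.
move=> n; split=> //; case: n => [|n].
  by rewrite S0 expr1n !mulr1 ler1n.
have Sw : w n <= 8 * S n.+1.
  rewrite SwE // big_ord_recl /= subn1 S0 mul1r lerDl sumr_ge0 // => i _.
  by rewrite mulr_ge0.
have := catalan8_low n zP; have := renewal_weight n zP; have := catalan8_ge0 n zP.
rewrite [8 ^+ n.+1]exprS -/(w n) -(natr1 n.+1).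
set x : R := n.+1%:R; have x1 : 1 <= x by rewrite ler1n.
move: (8 ^+ n) (z n.+1) (w n) (S n.+1) (Sge0 n.+1) Sw => e a v s s0 vs a0 av ea.
have h1 : 12 * a <= (x + 1) * (8 * s).
  by apply: le_trans av _; rewrite ler_wpM2l //; lra.
have h2 : x ^+ 2 * (12 * a) <= x ^+ 2 * ((x + 1) * (8 * s)).
  by rewrite ler_wpM2l // sqr_ge0.
have h3 : x ^+ 2 * ((x + 1) * (8 * s)) <= (x + 1) ^+ 3 * (8 * s).
  rewrite (exprSr (x + 1)) -[leRHS]mulrA ler_wpM2r //.
    by rewrite !mulr_ge0 //; lra.
  by rewrite ler_sqr ?nnegrE; lra.
have h4 : 0 <= (x + 1) ^+ 3 * s by rewrite mulr_ge0 // exprn_ge0; lra.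
have := le_trans h2 h3.
have -> : x ^+ 2 * (12 * a) = 12 * (x ^+ 2 * a) by ring.
have -> : (x + 1) ^+ 3 * (8 * s) = 8 * ((x + 1) ^+ 3 * s) by ring.
move=> h5; rewrite -[leRHS]mulrA; move: ea h4 h5.
move: (x ^+ 2 * a) ((x + 1) ^+ 3 * s) => p q ? ? ?.
by lra.
Qed.

Lemma catalytic_growth (R : realFieldType) (P : fps {poly R}) (S : nat -> R) :
  coef P 0 = 1 -> catalytic_eq P -> (forall n, (coef P n).[1] = S n) ->
  (forall n, 0 <= S n) ->
  forall n, S n <= 8 ^+ n /\ 8 ^+ n <= 64 * n.+1%:R ^+ 3 * S n.
Proof.
move=> P0 hP PS S_ge0; have [z [z0 zE]] := catalytic_solution P0 hP.
set A := fps_eval1 P; set X := fps_X {poly R}; set W := _ - 2 * X ^+ 2 => AW.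
pose ev (f : fps {poly R}) n : R := (coef f n).[1].
have evM f g n : ev (f * g) n = \sum_(i < n.+1) ev f i * ev g (n - i)%N.
  by rewrite /ev coefM_fps horner_sum; apply: eq_bigr => i _; rewrite hornerM.
have evnat k f n : ev (k%:R * f) n = k%:R * ev f n.
  by rewrite /ev coef_nat_fps !mulr_natl hornerMn.
have evD f g n : ev (f + g) n = ev f n + ev g n by rewrite /ev coefD_fps hornerD.
have evN f n : ev (- f) n = - ev f n by rewrite /ev coefN_fps hornerN.
have evX n : ev X n = (n == 1%N)%:R by rewrite /ev /= -polyC_natr hornerC.
have evXM f n : ev (X * f) n = if n is m.+1 then ev f m else 0.
  by rewrite /ev coef_XM; case: n => //; rewrite horner0.
have evA n : ev A n = S n by rewrite /ev coef_fps_eval1 hornerC PS.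
have S0 : S 0%N = 1 by rewrite -PS P0 hornerC.
have ez0 : ev z 0%N = 0 by rewrite /ev z0 horner0.
have ez1 : ev z 1%N = 1.
  rewrite zE evD evX evnat expr2 evM !big_ord_recr big_ord0 /= ez0.
  by rewrite mul0r mulr0 !addr0 mulr0 addr0.
have ezS n : (0 < n)%N -> n.+1%:R * ev z n.+1 = (8 * n%:R - 4) * ev z n.
  (* [y] is the square root of [1 - 8 x], and [(1 - 8 x) 2 y' = - 8 y] is the recursion of
     [catalan8]. *)
  move=> n0; pose y := 1 - 4 * z.
  have yy : y * y = 1 - 8 * X.
    have -> : X = z - 2 * z ^+ 2 by rewrite {1}zE addrK.
    by rewrite /y; ring.
  have ode : (1 - 8 * X) * (2 * fps_deriv y) = - 8 * y.
    have : fps_deriv (y * y) = - 8.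
      rewrite yy; apply: fpsP => m.
      have -> : coef (fps_deriv (1 - 8 * X)) m = coef (1 - 8 * X) m.+1 *+ m.+1 by [].
      rewrite coefB_fps coef1_fps sub0r coef_nat_fps coefN_fps -[8 in RHS]mulr1.
      rewrite coef_nat_fps coef1_fps.
      by case: m => [|m]; rewrite /= ?mulr1n // !mulr0 oppr0 mul0rn.
    rewrite fps_derivM -yy => d.
    transitivity ((fps_deriv y * y + y * fps_deriv y) * y); first by ring.
    by rewrite d.
  have evy m : ev y m.+1 = - (4 * ev z m.+1).
    by rewrite /y evD evN evnat /ev coef1_fps horner0 add0r.
  have evDy m : ev (fps_deriv y) m = m.+1%:R * - (4 * ev z m.+1).
    by rewrite -evy /ev /= hornerMn mulr_natl.
  have {}ode : 2 * fps_deriv y - 16 * (X * fps_deriv y) = - (8 * y).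
    by rewrite -[RHS]mulNr -ode; ring.
  have := congr1 (ev ^~ n) ode; case: n n0 => // n _.
  rewrite /= evD !evN !evnat evXM !evDy evy.
  move: (n.+2%:R) (n.+1%:R) (ev z n.+2) (ev z n.+1) => a b c d; lra.
apply: (@renewal_bounds _ _ (ev z)) => // n n0.
have eW m : ev W m.+2 = ev z m.+2 - 8 * ev z m.+1 - 2 *+ (m == 0)%N.
  have -> : W = z - 8 * (X * z) + 7 * X - 2 * (X * X) by rewrite /W; ring.
  rewrite !(evD, evN) !evnat !evXM !evX /= mulr0 addr0.
  by case: m => [|m] /=; rewrite ?mulr1 ?mulr0 ?mulr1n ?mulr0n.
have eW0 : ev W 0 = 0.
  have -> : W = z + X * (7 - 8 * z - 2 * X) by rewrite /W; ring.
  by rewrite evD evXM ez0 addr0.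
have eW1 : ev W 1 = 8.
  have -> : W = z - 8 * (X * z) + 7 * X - 2 * (X * X) by rewrite /W; ring.
  by rewrite !(evD, evN) !evnat !evXM !evX /= evX ez0 ez1 /=; lra.
(* [W] starts with [8 x], so the coefficient of order [n + 1] isolates [8 S n]. *)
have := congr1 (ev ^~ n.+1) AW.
rewrite /= evM evnat evX eqSS (gtn_eqF n0) mulr0.
rewrite !big_ord_recr /= subnn eW0 mulr0 addr0 subSnn eW1 evA.
move=> /eqP; rewrite addrC addr_eq0 mulrC => /eqP ->.
rewrite -sumrN; apply: eq_bigr => i _; rewrite evA -mulrN; congr (_ * _).
have ni : (0 < n - i)%N by rewrite subn_gt0.
have -> : (n.+1 - i = (n - i).+1)%N by lia.
by case: (n - i)%N ni => // m _; rewrite eW eqSS; ring.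
Qed.

(** * Walks on stacks *)

Lemma coefM_fps_recr (R : comNzRingType) (f g : fps R) n :
  coef g 0 = 0 ->
  coef (f * g) n.+1 = \sum_(i < n.+1) coef f i * coef g (n - i).+1.
Proof.
move=> g0; rewrite coefM_fps big_ord_recr /= subnn g0 mulr0 addr0.
by apply: eq_bigr => i _; rewrite subSn //; have := ltn_ord i; lia.
Qed.

(* A stack is listed from the bottom.  A move picks a height [0 <= h <= sumn s].  If
   [h] is a partial sum of [s], everything above [h] is merged with one new unit;
   otherwise everything above [h] is discarded, the entry containing [h] is cut at
   [h], and a new entry 1 is pushed. *)
Fixpoint moves (s : seq nat) : seq (seq nat) :=
  if s is d :: t then
    [:: (d + sumn t).+1] ::
      [seq [:: h; 1%N] | h <- index_iota 1 d] ++ [seq d :: t' | t' <- moves t]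
  else [:: [:: 1%N]].

(** The sum of [phi] over the end points of all [n]-step walks from [s]. Its linearity in [phi]
    replaces bijections between sets of walks. *)
Fixpoint walks (K : comNzRingType) (n : nat) (phi : seq nat -> K) (s : seq nat) : K :=
  if n is m.+1 then \sum_(s' <- moves s) walks m phi s' else phi s.

Lemma eq_walks (K : comNzRingType) n (phi psi : seq nat -> K) s :
  phi =1 psi -> walks n phi s = walks n psi s.
Proof.
move=> e; elim: n s => [|n IHn] s; first exact: e.
by apply: eq_bigr => s' _; exact: IHn.
Qed.

Lemma walksSr (K : comNzRingType) n (phi : seq nat -> K) s :
  walks n.+1 phi s = walks n (fun t => \sum_(s' <- moves t) phi s') s.
Proof. by elim: n s => [//|n IHn] s; apply: eq_bigr => s' _; exact: IHn. Qed.

Lemma walksD (K : comNzRingType) n (phi psi : seq nat -> K) s :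
  walks n (fun t => phi t + psi t) s = walks n phi s + walks n psi s.
Proof.
elim: n s => [//|n IHn] s /=; rewrite -big_split /=.
by apply: eq_bigr => s' _; exact: IHn.
Qed.

Lemma walksZ (K : comNzRingType) n c (phi : seq nat -> K) s :
  walks n (fun t => c * phi t) s = c * walks n phi s.
Proof.
elim: n s => [//|n IHn] s /=; rewrite mulr_sumr.
by apply: eq_bigr => s' _; exact: IHn.
Qed.

Lemma walksZr (K : comNzRingType) n c (phi : seq nat -> K) s :
  walks n (fun t => phi t * c) s = walks n phi s * c.
Proof.
by rewrite [RHS]mulrC -walksZ; apply: eq_walks => t; rewrite mulrC.
Qed.

Lemma walksB (K : comNzRingType) n (phi psi : seq nat -> K) s :
  walks n (fun t => phi t - psi t) s = walks n phi s - walks n psi s.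
Proof.
rewrite walksD; congr (_ + _); rewrite -mulN1r -walksZ.
by apply: eq_walks => t; rewrite mulN1r.
Qed.

(** [i] counts the moves before the last change of the bottom entry. In the second term the walk
    above has [n - i + 1] moves, because the fresh 1 is counted as its first move from the empty
    stack. *)
Definition first_return (K : comNzRingType) (n : nat) (phi : seq nat -> K) : K :=
  \sum_(i < n.+1)
   (walks i (fun s => walks (n - i) (fun t => phi ((sumn s).+1 :: t)) [::]) [::]
  + walks i (fun s => \sum_(1 <= h < head 0%N s)
               walks (n - i).+1 (fun t => phi (h :: t)) [::]) [::]).

(* Cut a walk from the empty stack at the last time its bottom entry changed:
   it was then rebuilt either by collapsing the whole stack [s] into
   [:: (sumn s).+1], or by lowering the bottom entry to [h] with a fresh 1 above;
   what happens afterwards above the bottom entry is again a walk from the empty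
   stack. *)
Lemma walks_first_return (K : comNzRingType) n (phi : seq nat -> K) :
  walks n.+1 phi [::] = first_return n phi.
Proof.
elim: n phi => [|n IHn] phi.
  by rewrite /first_return big_ord1 /= big_seq1 big_geq // addr0.
(* [G] collects the moves that change the bottom entry. *)
pose G s := phi [:: (sumn s).+1] + \sum_(1 <= h < head 0%N s) phi [:: h; 1%N].
have Lcons d t : \sum_(s' <- moves (d :: t)) phi s' =
    \sum_(t' <- moves t) phi (d :: t') + G (d :: t).
  by rewrite /= big_cons big_cat !big_map /= addrA addrC.
have nuL d j : walks j (fun t => \sum_(s' <- moves (d :: t)) phi s') [::] =
    walks j.+1 (fun t => phi (d :: t)) [::] + walks j (fun t => G (d :: t)) [::].
  by rewrite walksSr -walksD; apply: eq_walks => t; exact: Lcons.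
rewrite walksSr IHn.
(* An additional last move either stays above the bottom entry, lengthening the walk there, or
   changes it. By induction the latter moves sum to [walks n.+1 G], the new term [i = n + 1]. *)
transitivity (\sum_(i < n.+1)
   (walks i (fun s => walks (n - i).+1 (fun t => phi ((sumn s).+1 :: t)) [::]) [::]
  + walks i (fun s => \sum_(1 <= h < head 0%N s)
               walks (n - i).+2 (fun t => phi (h :: t)) [::]) [::])
   + first_return n G).
  rewrite /first_return -big_split; apply: eq_bigr => i _.
  rewrite [RHS]addrACA; congr (_ + _); rewrite -walksD; apply: eq_walks => s.
    exact: nuL.
  rewrite -big_split; apply: eq_bigr => h _; exact: (nuL h (n - i).+1).
rewrite -IHn /first_return [in RHS]big_ord_recr; congr (_ + _).
  apply: eq_bigr => i _.
  have e : (n.+1 - i = (n - i).+1)%N by have := ltn_ord i; lia.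
  by rewrite -e.
rewrite [in RHS]subnn -[RHS]walksD; apply: eq_walks => s.
by congr (_ + _); apply: eq_bigr => h _; rewrite /= big_seq1.
Qed.

(** [u] marks the total height in [top_poly]; in [cut_poly] it marks the heights strictly inside the
    bottom entry, where it can be cut. *)
Definition top_poly (R : comNzRingType) n : {poly R} :=
  walks n (fun s => 'X^(sumn s)) [::].
Definition cut_poly (R : comNzRingType) n : {poly R} :=
  walks n (fun s => \sum_(1 <= h < head 0%N s) 'X^h) [::].
Definition walk_count (R : comNzRingType) n : {poly R} :=
  walks n (fun=> 1) [::].

Lemma horner_walks (R : comNzRingType) n (phi : seq nat -> {poly R}) s x :
  (walks n phi s).[x] = walks n (fun t => (phi t).[x]) s.
Proof.
elim: n s => [//|n IHn] s /=; rewrite horner_sum.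
by apply: eq_bigr => s' _; exact: IHn.
Qed.

Lemma polyC_walks (R : comNzRingType) n (phi : seq nat -> R) s :
  (walks n phi s)%:P = walks n (fun t => (phi t)%:P) s.
Proof.
elim: n s => [//|n IHn] s /=; rewrite rmorph_sum /=.
by apply: eq_bigr => s' _; exact: IHn.
Qed.

Lemma top_poly1 (R : comNzRingType) n : (top_poly R n).[1]%:P = walk_count R n.
Proof.
rewrite horner_walks polyC_walks; apply: eq_walks => s.
by rewrite hornerXn expr1n polyC1.
Qed.

Lemma cut_poly1 (R : comNzRingType) n :
  (cut_poly R n).[1]%:P = walks n (fun s => \sum_(1 <= h < head 0%N s) 1) [::].
Proof.
rewrite horner_walks polyC_walks; apply: eq_walks => s.
rewrite horner_sum rmorph_sum /=; apply: eq_bigr => h _.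
by rewrite hornerXn expr1n polyC1.
Qed.

Lemma walks_const (K : comNzRingType) n (c : K) s :
  walks n (fun=> c) s = c * walks n (fun=> 1) s.
Proof. by rewrite -walksZ; apply: eq_walks => t; rewrite mulr1. Qed.

(** The weight [u^(sumn s)] is multiplicative in the bottom entry and the stack above it, so both
    terms of [first_return] become convolutions. *)
Lemma top_polyS (R : comNzRingType) n :
  top_poly R n.+1 = \sum_(i < n.+1)
    ('X * (top_poly R i * top_poly R (n - i)) + cut_poly R i * top_poly R (n - i).+1).
Proof.
have shift d j : walks j (fun t => 'X^(sumn (d :: t))) [::] = 'X^d * top_poly R j.
  by rewrite -walksZ; apply: eq_walks => t; rewrite /= exprD.
rewrite /top_poly walks_first_return; apply: eq_bigr => i _; congr (_ + _).
  rewrite mulrA -(walksZ _ 'X) -walksZr; apply: eq_walks => s.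
  by rewrite shift exprS.
rewrite -walksZr; apply: eq_walks => s; rewrite mulr_suml.
by apply: eq_bigr => h _; exact: shift.
Qed.

Lemma geom_sum1 (R : comNzRingType) d :
  (1 - 'X : {poly R}) * (\sum_(1 <= h < d.+1) 'X^h) = 'X - 'X^(d.+1).
Proof.
elim: d => [|d IHd]; first by rewrite big_geq // mulr0 expr1 subrr.
by rewrite big_nat_recr //= mulrDr IHd !exprS; ring.
Qed.

(** After its last change the bottom entry is [d = sumn s + 1] or [d = h], and
    [(1 - u) (u + ... + u^(d-1)) = u - u^d]. The stack above is arbitrary, whence the factors
    [walk_count]. *)
Lemma cut_polyS (R : comNzRingType) n :
  (1 - 'X) * cut_poly R n.+1 = \sum_(i < n.+1)
    ('X * (walk_count R i - top_poly R i) * walk_count R (n - i)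
     + ('X * (cut_poly R i).[1]%:P - cut_poly R i) * walk_count R (n - i).+1).
Proof.
rewrite /cut_poly walks_first_return mulr_sumr; apply: eq_bigr => i _.
rewrite mulrDr -!(walksZ i (1 - 'X)); congr (_ + _).
  rewrite /walk_count /top_poly -walksB -(walksZ _ 'X) -(walksZr i); apply: eq_walks => s.
  by rewrite /= [X in _ * X]walks_const [LHS]mulrA geom_sum1 exprS; ring.
rewrite -/(cut_poly R i) cut_poly1 -(walksZ _ 'X) -walksB -(walksZr i); apply: eq_walks => s.
rewrite 2!mulr_sumr -sumrB mulr_suml; apply: eq_big_nat => h /andP[h0 _].
have -> : walks (n - i).+1 (fun t => \sum_(1 <= k < head 0%N (h :: t)) 'X^k) [::] =
    (\sum_(1 <= k < h) 'X^k) * walk_count R (n - i).+1 by rewrite /walk_count -walks_const.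
rewrite mulr1 [LHS]mulrA; congr (_ * _).
by case: h h0 => // h _; exact: geom_sum1.
Qed.

Definition top_fps (R : comNzRingType) : fps {poly R} := Fps (top_poly R).

(** The series [r] of the cut polynomials is eliminated: [PE] at [u = 1] expresses [r(1) (A - 1)],
    which turns [rE] into a formula for [r (A - U)]; this removes [r] from [PE] multiplied by
    [A - U]. *)
Lemma catalytic_top_fps (R : comNzRingType) : catalytic_eq (top_fps R).
Proof.
set P := top_fps R; pose r : fps {poly R} := Fps (cut_poly R).
rewrite /catalytic_eq; set A := fps_eval1 P; set X := fps_X {poly R}; set U := fps_U R.
have coefA n : coef A n = walk_count R n by rewrite coef_fps_eval1 top_poly1.
have PE : P - 1 = X * (U * (P * P)) + r * (P - 1).
  apply: fpsP => -[|n].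
    by rewrite [in RHS]coefD_fps coef_XM add0r coefM_fps big_ord1 !coefB_fps /= subrr mulr0.
  rewrite coefB_fps coef1_fps subr0 coefD_fps [LHS]top_polyS big_split; congr (_ + _).
    by rewrite coef_XM coef_constM coefM_fps mulr_sumr.
  rewrite coefM_fps_recr; last by rewrite coefB_fps /= subrr.
  by apply: eq_bigr => i _; rewrite coefB_fps coef1_fps subr0.
have rE : (1 - U) * r = X * (U * (A - P) * A) + (U * fps_eval1 r - r) * (A - 1).
  have -> : 1 - U = fps_const (1 - 'X).
    by apply: fpsP => -[|m]; rewrite coefB_fps coef1_fps /= ?subr0.
  have A0 : coef (A - 1) 0 = 0 by rewrite coefB_fps coefA subrr.
  apply: fpsP => n; rewrite coef_constM coefD_fps coef_XM; case: n => [|n].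
    rewrite coefM_fps big_ord1 A0 mulr0 addr0 /= /cut_poly /= big_geq //.
    by rewrite mulr0.
  rewrite cut_polyS big_split; congr (_ + _).
    rewrite coefM_fps; apply: eq_bigr => i _.
    by rewrite coef_constM coefB_fps !coefA.
  rewrite coefM_fps_recr //; apply: eq_bigr => i _.
  by rewrite (coefB_fps A) coefA coef1_fps subr0 coefB_fps coef_constM coef_fps_eval1.
have AE : A - 1 = X * (A * A) + fps_eval1 r * (A - 1).
  have := congr1 (@fps_eval1 R) PE.
  rewrite /fps_eval1 fps_mapB fps_map1 fps_mapD !fps_mapM fps_mapX fps_mapB fps_map1.
  by rewrite -!/(fps_eval1 _) fps_eval1U mul1r.
have rA : r * (A - U) = U * (A - 1 - X * P * A).
  transitivity ((1 - U) * r + r * (A - 1)); first by ring.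
  rewrite rE; transitivity (X * (U * (A - P) * A) + U * (fps_eval1 r * (A - 1))).
    by ring.
  have -> : fps_eval1 r * (A - 1) = A - 1 - X * (A * A) by rewrite {2}AE; ring.
  by ring.
have key : (P - 1 - X * (U * (P * P))) * (A - U) = U * (A - 1 - X * P * A) * (P - 1).
  by rewrite -rA {1}PE; ring.
apply/eqP; rewrite -subr_eq0; apply/eqP.
transitivity ((P - 1 - X * (U * (P * P))) * (A - U) - U * (A - 1 - X * P * A) * (P - 1)).
  by ring.
by rewrite key subrr.
Qed.

Lemma walks_growth (R : realFieldType) n :
  let S := walks n (fun=> 1 : R) [::] in
  S <= 8 ^+ n /\ 8 ^+ n <= 64 * n.+1%:R ^+ 3 * S.
Proof.
have walks_ge0 m s : 0 <= walks m (fun=> 1 : R) s.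
  by elim: m s => [|m IHm] s //=; apply: sumr_ge0.
move: n; apply: (@catalytic_growth R (top_fps R)) => //.
- exact: catalytic_top_fps.
- move=> n; rewrite horner_walks; apply: eq_walks => s.
  by rewrite hornerXn expr1n.
Qed.

(** * Pattern occurrences *)

(** Containment for an arbitrary word [w] with positions restricted to [A], so that occurrences can
    be split and transported between permutations. *)
Definition occurs (n k : nat) (q : 'S_k) (w : 'I_n -> nat) (A : pred 'I_n) : Prop :=
  exists f : 'I_k -> 'I_n,
    [/\ forall a b : 'I_k, (a < b)%N -> (f a < f b)%N,
        forall a b : 'I_k, (w (f a) < w (f b))%N = (q a < q b)%N
      & forall a, A (f a)].

Definition value (n : nat) (p : 'S_n) (i : 'I_n) : nat := p i.

Lemma containsP (n k : nat) (p : 'S_n) (q : 'S_k) :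
  reflect (occurs q (value p) predT) (contains p q).
Proof.
apply: (iffP existsP) => [[f /andP[/forallP f1 /forallP f2]]|[f [f1 f2 _]]].
  exists f; split=> // a b; first by move/forallP: (f1 a) => /(_ b)/implyP.
  by move/forallP: (f2 a) => /(_ b)/eqP.
exists [ffun a => f a]; apply/andP; split.
  by apply/forallP => a; apply/forallP => b; rewrite !ffunE; apply/implyP; exact: f1.
by apply/forallP => a; apply/forallP => b; rewrite !ffunE; apply/eqP; exact: f2.
Qed.

Lemma occurs_map (n m k : nat) (q : 'S_k) (w : 'I_n -> nat) (w' : 'I_m -> nat)
    (A : pred 'I_n) (B : pred 'I_m) (g : 'I_n -> 'I_m) :
  {in A &, forall i j : 'I_n, (i < j)%N -> (g i < g j)%N} ->
  {in A &, forall i j, (w i < w j)%N = (w' (g i) < w' (g j))%N} ->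
  {in A, forall i, B (g i)} ->
  occurs q w A -> occurs q w' B.
Proof.
move=> gmono gord gB [f [f1 f2 f3]]; exists (g \o f); split=> [a b ab|a b|a] /=.
- by apply: gmono; [exact: f3|exact: f3|exact: f1].
- by rewrite -gord ?f2 //; exact: f3.
- by apply: gB; exact: f3.
Qed.

Lemma occurs_sub (n k : nat) (q : 'S_k) (w : 'I_n -> nat) (A B : pred 'I_n) :
  (forall i, A i -> B i) -> occurs q w A -> occurs q w B.
Proof. by move=> AB; apply: (@occurs_map _ _ _ _ _ _ _ _ id) => // i /AB. Qed.

Definition front (k : nat) (q : 'S_k) : 'S_k.+1 := lift_perm ord0 ord0 q.

Lemma ltn_lift0 (n : nat) (i j : 'I_n) : (lift ord0 i < lift ord0 j)%N = (i < j)%N.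
Proof. by []. Qed.

Lemma occurs_front (n k : nat) (q : 'S_k) (w : 'I_n -> nat) (A : pred 'I_n) :
  occurs (front q) w A <->
  exists2 i, A i & occurs q w [pred j : 'I_n | [&& A j, (i < j)%N & (w i < w j)%N]].
Proof.
split=> [[f [f1 f2 f3]]|[i Ai [g [g1 g2 g3]]]].
  exists (f ord0) => //; exists (fun a => f (lift ord0 a)); split=> [a b ab|a b|a].
  - exact: f1.
  - by rewrite f2 !lift_perm_lift.
  - by rewrite /= f3 f1 // f2 lift_perm_id lift_perm_lift.
pose f (a : 'I_k.+1) := if unlift ord0 a is Some b then g b else i.
have f0 : f ord0 = i by rewrite /f unlift_none.
have fS a : f (lift ord0 a) = g a by rewrite /f liftK.
exists f; split=> [a b|a b|a].
- case: (unliftP ord0 a) => [a' ->|->]; case: (unliftP ord0 b) => [b' ->|->] //.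
    by rewrite !fS ltn_lift0; exact: g1.
  by rewrite f0 fS; have /and3P[] := g3 b'.
- case: (unliftP ord0 a) => [a' ->|->]; case: (unliftP ord0 b) => [b' ->|->];
    rewrite ?f0 ?fS ?lift_perm_lift ?lift_perm_id.
  + exact: g2.
  + by have /and3P[_ _ ia] := g3 a'; rewrite ltnNge ltnW.
  + by have /and3P[_ _ ->] := g3 b'.
  + by rewrite !ltnn.
- case: (unliftP ord0 a) => [a' ->|->]; rewrite ?f0 ?fS //.
  by have /and3P[] := g3 a'.
Qed.

(** The first entry of [front r] is below and before all the others, so an occurrence stays on the
    side of [B] on which it starts. *)
Lemma occurs_skew (n k : nat) (r : 'S_k) (w : 'I_n -> nat) (A B : pred 'I_n) :
  (forall i j, A i -> A j -> B i -> ~~ B j -> (i < j)%N && (w j < w i)%N) ->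
  occurs (front r) w A ->
  occurs (front r) w [pred i | A i && B i] \/ occurs (front r) w [pred i | A i && ~~ B i].
Proof.
move=> skew [f [f1 f2 f3]].
have [Bf0|Bf0] := boolP (B (f ord0)); [left|right]; exists f; split=> // a;
  rewrite /= f3 /=; case: (unliftP ord0 a) => [b ->|->] //.
- apply/negPn/negP => Bb; have /andP[_] := skew _ _ (f3 ord0) (f3 _) Bf0 Bb.
  by rewrite f2 lift_perm_id.
- apply/negP => Bb; have /andP[] := skew _ _ (f3 _) (f3 ord0) Bb Bf0.
  by rewrite ltnNge ltnW // f1.
Qed.

(** [lift_perm ord0 a p] puts an entry [a] in front of [p] and raises the values [>= a] by one. This
    preserves the order of the old entries. *)
Lemma occurs_lift (n k : nat) (q : 'S_k) (a : 'I_n.+1) (p : 'S_n) (B : pred 'I_n.+1) :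
  ~~ B ord0 ->
  occurs q (value (lift_perm ord0 a p)) B <->
  occurs q (value p) [pred j | B (lift ord0 j)].
Proof.
have vlift j : value (lift_perm ord0 a p) (lift ord0 j) = bump a (p j).
  by rewrite /value lift_perm_lift.
move=> B0; split.
  move=> [f [f1 f2 f3]].
  have f_neq0 x : ord0 != f x.
    by apply/eqP => e; move: (f3 x); rewrite -e (negPf B0).
  pose g x := s2val (unlift_some (f_neq0 x)).
  have fE x : f x = lift ord0 (g x) := s2valP (unlift_some (f_neq0 x)).
  exists g; split=> [x y xy|x y|x]; last by rewrite /= -fE.
    by rewrite -ltn_lift0 -!fE f1.
  by rewrite -f2 !fE !vlift /value /bump; lia.
apply: (@occurs_map _ _ _ _ _ _ _ _ (lift ord0)) => // i j _ _.
by rewrite !vlift /value /bump; lia.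
Qed.

Lemma occurs_front_insert (n k : nat) (q : 'S_k) (a : 'I_n.+1) (p : 'S_n) :
  occurs (front q) (value (lift_perm ord0 a p)) predT <->
  occurs (front q) (value p) predT \/ occurs q (value p) [pred j | (a <= p j)%N].
Proof.
set p' := lift_perm ord0 a p.
have vlift j : value p' (lift ord0 j) = bump a (p j) by rewrite /value lift_perm_lift.
have v0 : value p' ord0 = a by rewrite /value lift_perm_id.
split=> [/occurs_front[i _]|[/occurs_front[i _]|]].
- case: (unliftP ord0 i) => [i' ->|->] occ; [left|right].
    apply/occurs_front; exists i' => //; move: occ => /occurs_lift -/(_ isT).
    by apply: occurs_sub => j; rewrite /= ltn_lift0 !vlift /value /bump => /andP[-> /=]; lia.
  move: occ => /occurs_lift -/(_ isT); apply: occurs_sub => j.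
  by rewrite /= v0 vlift /bump; lia.
- move=> occ; apply/occurs_front; exists (lift ord0 i) => //.
  apply/occurs_lift => //; move: occ; apply: occurs_sub => j.
  by rewrite /= ltn_lift0 !vlift /value /bump => /andP[-> /=]; lia.
- move=> occ; apply/occurs_front; exists ord0 => //.
  apply/occurs_lift => //; move: occ; apply: occurs_sub => j.
  by rewrite /= v0 vlift /bump; lia.
Qed.

Lemma sum_front_insert (V : nmodType) (n : nat) (F : 'S_n.+1 -> V) :
  \sum_(p : 'S_n.+1) F p =
  \sum_(p : 'S_n) \sum_(a : 'I_n.+1) F (lift_perm ord0 a p).
Proof.
pose ins (x : 'S_n * 'I_n.+1) := lift_perm ord0 x.2 x.1.
have ins_inj : injective ins.
  move=> [p a] [p' a'] /= e.
  have ea : a = a' by have := congr1 (fun s : 'S_n.+1 => s ord0) e; rewrite !lift_perm_id.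
  rewrite -ea in e *; congr (_, _); apply/permP => i.
  have := congr1 (fun s : 'S_n.+1 => s (lift ord0 i)) e; rewrite !lift_perm_lift /=.
  exact: lift_inj.
have ins_bij : bijective ins.
  apply: inj_card_bij => //.
  by rewrite card_prod !card_Sn card_ord factS mulnC.
by rewrite (reindex ins) /= ?pair_bigA //; exact: onW_bij.
Qed.

(** * Avoiding 1342 *)

(** The single move of [moves] at height [h]; [boundary s h] tells whether [h] is a partial sum of
    [s]. *)
Fixpoint move_to (s : seq nat) (h : nat) : seq nat :=
  if s is d :: t then
    if h == 0%N then [:: (d + sumn t).+1]
    else if (h < d)%N then [:: h; 1%N] else d :: move_to t (h - d)
  else [:: 1%N].

Fixpoint boundary (s : seq nat) (h : nat) : bool :=
  (h == 0%N) || (if s is d :: t then (d <= h)%N && boundary t (h - d) else false).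

Definition positive (s : seq nat) := all (ltn 0) s.

Lemma movesE (s : seq nat) :
  positive s -> moves s = [seq move_to s h | h <- iota 0 (sumn s).+1].
Proof.
elim: s => [//|d t IHt] /= /andP[d0 t0]; rewrite IHt //.
have -> : iota 1 (d + sumn t) = index_iota 1 d ++ [seq (d + h)%N | h <- iota 0 (sumn t).+1].
  have -> : (d + sumn t = (d - 1) + (sumn t).+1)%N by lia.
  rewrite iotaD -/(index_iota 1 d) (_ : 1 + (d - 1) = d)%N; last by lia.
  by rewrite -iotaDl addn0.
rewrite map_cat -!map_comp; congr (_ :: _); congr (_ ++ _).
  apply/eq_in_map => h; rewrite mem_index_iota => /andP[h0 hd].
  by rewrite (gtn_eqF h0) hd.
apply/eq_in_map => h _ /=; have -> : ((d + h == 0) = false)%N by lia.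
have -> : (d + h < d = false)%N by lia.
by rewrite addKn.
Qed.

Lemma positive_move_to (s : seq nat) h : positive s -> positive (move_to s h).
Proof.
rewrite /positive; elim: s h => [//|d t IHt] h /= /andP[d0 t0].
case: eqVneq => //= h0; case: ifP => //= hd; first by rewrite lt0n h0.
by rewrite d0 IHt.
Qed.

Lemma sumn_move_to (s : seq nat) h : (h <= sumn s)%N ->
  sumn (move_to s h) = if boundary s h then (sumn s).+1 else h.+1.
Proof.
elim: s h => [|d t IHt] h /=; first by rewrite leqn0 => /eqP ->.
move=> hs; case: eqVneq => [_|h0] /=; first by rewrite addn0.
case: ltnP => hd /=; first by lia.
rewrite IHt; last by lia.
by case: ifP => _; lia.
Qed.

Lemma boundary_move_to (s : seq nat) h g : positive s -> (h <= sumn s)%N ->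
  boundary (move_to s h) g =
  if boundary s h then (g <= h)%N && boundary s g || (g == (sumn s).+1)
  else [|| (g < h)%N && boundary s g, g == h | g == h.+1].
Proof.
rewrite /positive; elim: s h g => [|d t IHt] h g /=.
  by move=> _; rewrite leqn0 => /eqP ->; case: g => [|[|g]] /=; lia.
move=> /andP[d0 t0] hs; case: eqVneq => [->|h0] /=.
  by case: g => [|g] /=; lia.
case: ltnP => hd /=.
  have [->|g0] /= := eqVneq g 0%N; first by lia.
  have -> : ((g < h) && ((d <= g) && boundary t (g - d)) = false)%N.
    by case: (ltnP g h) => //= gh; rewrite leqNgt (ltn_trans gh hd).
  lia.
have hdt : (h - d <= sumn t)%N by lia.
rewrite IHt //.
have [->|g0] /= := eqVneq g 0%N; first by case: ifP => _; lia.
by case: ifP => _; case: (leqP d g) => dg /=; lia.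
Qed.

(** * Active levels under insertion in front *)

(** Level [v] lies just below the entry of value [v]. It is active when a new front entry [v] is not
    the 1 of any 1342; [pattern_q 3] is 231. *)
Definition active (n : nat) (p : 'S_n) (v : nat) : Prop :=
  ~ occurs (pattern_q 3) (value p) [pred j | (v <= p j)%N].

(** Only inversions among the entries [>= v0] count; [v0] will be the lowest active level. *)
Definition no_inversion_across (n : nat) (p : 'S_n) (v0 v : nat) : Prop :=
  forall i j : 'I_n, (i < j)%N -> (v <= p i)%N -> (v0 <= p j < v)%N -> False.

Lemma occurs_231 (n : nat) (w : 'I_n -> nat) (A : pred 'I_n) :
  occurs (pattern_q 3) w A <->
  exists i j k : 'I_n, [/\ A i, A j & A k] /\ [/\ (i < j)%N, (j < k)%N & (w k < w i < w j)%N].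
Proof.
have q3 (a : 'I_3) : pattern_q 3 a = pattern_q_val 3 a :> nat by rewrite permE.
split=> [[f [f1 f2 f3]]|[i [j [k [[Ai Aj Ak] [ij jk /andP[ki wij]]]]]]].
  exists (f ord0), (f (Ordinal (isT : 1 < 3)%N)), (f (Ordinal (isT : 2 < 3)%N)).
  by split; split; rewrite ?f3 ?f1 // !f2 !q3.
exists (fun a : 'I_3 => if a == 0%N :> nat then i else if a == 1%N :> nat then j else k).
split=> [[[|[|[|a]]] //= ha] [[|[|[|b]]] //= hb]|[[|[|[|a]]] //= ha] [[|[|[|b]]] //= hb]
  |[[|[|[|a]]] //= ha]]; rewrite ?q3 /pattern_q_val /=; lia.
Qed.

Lemma active_front_gt (n : nat) (a : 'I_n.+1) (p : 'S_n) v : (a < v)%N ->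
  active (lift_perm ord0 a p) v <-> active p v.-1.
Proof.
move=> av; rewrite /active; split; apply: contra_not => occ.
  apply/occurs_lift; first by rewrite /= lift_perm_id; lia.
  by move: occ; apply: occurs_sub => j /=; rewrite lift_perm_lift /= /bump; lia.
have B0 : ~~ [pred j | (v <= lift_perm ord0 a p j)%N] ord0.
  by rewrite /= lift_perm_id; lia.
have [+ _] := occurs_lift (pattern_q 3) a p B0; move=> /(_ occ).
by apply: occurs_sub => j /=; rewrite lift_perm_lift /= /bump; lia.
Qed.

(** The new entry [a] can only be the 2 of a 231, and then the 3 and the 1 form an inversion across
    [a]. *)
Lemma active_front_le (n : nat) (a : 'I_n.+1) (p : 'S_n) v : (v <= a)%N ->
  active (lift_perm ord0 a p) v <-> active p v /\ no_inversion_across p v a.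
Proof.
move=> va; set p' := lift_perm ord0 a p.
have vlift j : p' (lift ord0 j) = bump a (p j) :> nat by rewrite lift_perm_lift.
have v0 : p' ord0 = a :> nat by rewrite lift_perm_id.
split=> [act|[act inv]].
  split.
    apply: contra_not act => occ.
    apply: (@occurs_sub _ _ _ _ [pred j | (j != ord0) && (v <= p' j)%N]).
      by move=> j /andP[].
    apply/occurs_lift => //; move: occ; apply: occurs_sub => j /=.
    by rewrite vlift /bump; lia.
  move=> i j ij ai /andP[vj ja]; apply: act; apply/occurs_231.
  exists ord0, (lift ord0 i), (lift ord0 j).
  by split; split; rewrite /value /= ?vlift ?v0 /bump //; lia.
move=> /occurs_231[i [j [k [[Ai Aj Ak] [ij jk /andP[ki wij]]]]]].
move: Ai Aj Ak ij jk ki wij; rewrite /value /=.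
case: (unliftP ord0 k) => [k' ->|->] //; case: (unliftP ord0 j) => [j' ->|->] //.
case: (unliftP ord0 i) => [i' ->|->]; rewrite ?vlift ?v0 => Ai Aj Ak ij jk ki wij.
  apply: act; apply/occurs_231; exists i', j', k'.
  by split; split; move: Ai Aj Ak ij jk ki wij; rewrite /value /= /bump /=; lia.
apply: (inv j' k'); [exact: jk| |]; move: Ai Aj Ak ki wij; rewrite /bump; lia.
Qed.

Lemma no_inversion_front_gt (n : nat) (a : 'I_n.+1) (p : 'S_n) v0 v :
  (v0 <= a)%N -> (a < v)%N ->
  no_inversion_across (lift_perm ord0 a p) v0 v <-> no_inversion_across p v0 v.-1.
Proof.
move=> v0a av; split=> inv i j.
  move=> ij vi vj; apply: (inv (lift ord0 i) (lift ord0 j)) => //;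
    by rewrite lift_perm_lift /= /bump; lia.
case: (unliftP ord0 i) => [i' ->|->]; case: (unliftP ord0 j) => [j' ->|->] //;
  rewrite ?lift_perm_id ?lift_perm_lift /= ?/bump.
  by move=> ij vi vj; apply: (inv i' j'); [exact: ij|lia|lia].
by lia.
Qed.

(** If [v0 < v], the new first entry and the entry of value [v0] form an inversion across [v]. *)
Lemma no_inversion_front_le (n : nat) (a : 'I_n.+1) (p : 'S_n) v0 v :
  (v <= a)%N ->
  no_inversion_across (lift_perm ord0 a p) v0 v <-> (v <= v0)%N.
Proof.
move=> va; split=> [inv|vv0 i j _ _]; last by lia.
rewrite leqNgt; apply/negP => v0v.
have v0n : (v0 < n)%N by have := ltn_ord a; lia.
pose j := (p^-1)%g (Ordinal v0n).
apply: (inv ord0 (lift ord0 j)) => //; rewrite ?lift_perm_id //.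
by rewrite lift_perm_lift permKV /= /bump; lia.
Qed.

(* Look at the entry of value [v - 1]: if it precedes [i] it starts a 231 with [i]
   and [j], so it follows [i] and can replace [j]. *)
Lemma inversion_top (n : nat) (p : 'S_n) (v0 v : nat) (i j : 'I_n) :
  active p v0 -> (i < j)%N -> (v <= p i)%N -> (v0 <= p j < v)%N ->
  exists i' j' : 'I_n, [/\ (i' < j')%N, (v <= p i')%N & p j' = v.-1 :> nat].
Proof.
move=> act ij vi vj; have v1n : (v.-1 < n)%N by have := ltn_ord (p i); lia.
pose k := (p^-1)%g (Ordinal v1n).
have pk : p k = v.-1 :> nat by rewrite permKV.
have [ki|ki] := ltnP k i; last first.
  exists i, k; split=> //; rewrite ltn_neqAle ki andbT.
  by apply/eqP => /val_inj e; move: pk; rewrite -e; lia.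
case: act; apply/occurs_231; exists k, i, j.
have pkj : p k != p j by rewrite (inj_eq perm_inj); apply/eqP => e; move: ij ki; rewrite e; lia.
have : (p k : nat) != p j by [].
by split; split; rewrite /value /=; lia.
Qed.

(* [s] lists, from the largest value down, the distances between consecutive levels
   of the active part of [p] that no inversion crosses; [boundary s h] refers to the
   level with [h] values above it. *)
Definition state (n : nat) (p : 'S_n) (s : seq nat) : Prop :=
  [/\ positive s, (sumn s <= n)%N,
      forall v, (v <= n)%N -> active p v <-> (n - sumn s <= v)%N
    & forall h, (h <= sumn s)%N ->
        boundary s h <-> no_inversion_across p (n - sumn s) (n - h)].

(** Levels above [a] keep their status. If no inversion crosses [a], the active levels below it
    survive, but the new entry crosses them and merges that part of the stack. If some inversion
    crosses [a], all levels below [a] become inactive and the stack is cut there. *)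
Lemma state_front (n : nat) (p : 'S_n) (s : seq nat) (a : 'I_n.+1) :
  state p s -> (n - a <= sumn s)%N ->
  state (lift_perm ord0 a p) (move_to s (n - a)).
Proof.
move=> [s0 sn act bd] hs; set h := (n - a)%N in hs *.
have an : (a <= n)%N by have := ltn_ord a.
have aE : (a = n - h :> nat)%N by rewrite /h subKn.
have ma : (n - sumn s <= a)%N by lia.
have actm : active p (n - sumn s) by apply/act; lia.
have bda : boundary s h <-> no_inversion_across p (n - sumn s) a by rewrite bd // -aE.
split; first exact: positive_move_to.
- by rewrite sumn_move_to //; case: ifP; lia.
- move=> v vn; rewrite sumn_move_to //.
  have [av|va] := ltnP a v.
    rewrite active_front_gt // act; last by lia.
    by case: ifP; lia.
  rewrite active_front_le // act; last by lia.
  have [bh|bh] := boolP (boundary s h).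
    split=> [[mv _]|mv]; first by lia.
    split; first by lia.
    move=> i j ij ai /andP[vj ja]; apply: (bda.1 bh i j) => //; lia.
  split=> [[mv inv]|av]; last first.
    by split; [lia|move=> i j _ _; lia].
  rewrite leqNgt; apply/negP => va'; case/negP: bh; apply/bda => i j ij ai aj.
  (* The lower entry can be taken of value [a - 1], so that one inversion blocks every level
     [v < a]. *)
  have [i' [j' [ij' ai' aj']]] := inversion_top actm ij ai aj.
  by apply: (inv i' j') => //; lia.
- move=> g; rewrite sumn_move_to // boundary_move_to //.
  have [bh|bh] := boolP (boundary s h) => gm.
    have [gh|gh] := leqP g h => /=.
      have -> : (g == (sumn s).+1) = false by lia.
      rewrite orbF bd; last by lia.
      rewrite no_inversion_front_gt; [|lia|lia].
      have -> : (n.+1 - (sumn s).+1 = n - sumn s)%N by lia.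
      by have -> // : ((n.+1 - g).-1 = n - g)%N by lia.
    by rewrite no_inversion_front_le; lia.
  have -> : (n.+1 - h.+1 = a)%N by lia.
  have [gh|gh] := leqP g h; last first.
    by rewrite no_inversion_front_le; lia.
  rewrite no_inversion_front_gt; [|lia|lia].
  have -> : ((n.+1 - g).-1 = n - g)%N by lia.
  have [->|ngh] := eqVneq g h.
    by rewrite orbT; split=> // _ i j _ _; lia.
  have {}gh : (g < h)%N by lia.
  rewrite gh /= (_ : g == h.+1 = false) ?orbF; last by lia.
  rewrite bd; last by lia.
  split=> inv i j ij gi gj; first by apply: (inv i j) => //; lia.
  (* The lower entry can be taken of value [n - g - 1 >= a], hence within the shortened active
     part. *)
  have [i' [j' [ij' gi' gj']]] := inversion_top actm ij gi gj.
  by apply: (inv i' j') => //; lia.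
Qed.

Lemma pattern_qE (k : nat) (i : 'I_k) : pattern_q k i = pattern_q_val k i :> nat.
Proof. by rewrite permE. Qed.

Lemma pattern_q_front (k : nat) : (3 <= k)%N -> pattern_q k.+1 = front (pattern_q k).
Proof.
move=> k3; apply/permP => i; apply: val_inj; rewrite /= pattern_qE.
case: (unliftP ord0 i) => [j ->|->].
  rewrite lift_perm_lift /= pattern_qE /pattern_q_val /bump /=.
  have -> : (k.+1 - 3 = (k - 3).+1)%N by lia.
  rewrite add1n ltnS; case: ifP => // _.
  by case: k k3 {i} j => // k k3 j; rewrite eqSS; case: ifP.
by rewrite lift_perm_id /pattern_q_val; case: k k3 {i} => [|[|[|k]]].
Qed.

(** Counts the descendants of [p], [k] generations below it, in the generating tree of the
    1342-avoiders. *)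
Fixpoint extensions (k n : nat) (p : 'S_n) : nat :=
  if k is k'.+1 then \sum_(a : 'I_n.+1) extensions k' (lift_perm ord0 a p)
  else avoids p (pattern_q 4).

Lemma sum_extensions (k n : nat) :
  (\sum_(p : 'S_n) extensions k p)%N = num_avoiders (pattern_q 4) (n + k).
Proof.
elim: k n => [|k IHk] n /=; last by rewrite -sum_front_insert IHk addSnnS.
rewrite addn0 /num_avoiders -sum1dep_card [RHS]big_mkcond.
by apply: eq_bigr => p _; case: avoids.
Qed.

Lemma avoids_front (n : nat) (a : 'I_n.+1) (p : 'S_n) :
  avoids (lift_perm ord0 a p) (pattern_q 4) <-> avoids p (pattern_q 4) /\ active p a.
Proof.
rewrite /avoids pattern_q_front //; split=> [/containsP av|[/containsP av act]].
  by split; [apply/containsP|] => occ; apply: av; apply/occurs_front_insert; [left|right].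
by apply/containsP => /occurs_front_insert[].
Qed.

Lemma extensions_contains (k n : nat) (p : 'S_n) :
  ~~ avoids p (pattern_q 4) -> extensions k p = 0%N.
Proof.
elim: k n p => [|k IHk] n p /= np; first by rewrite (negPf np).
by rewrite big1 // => a _; apply: IHk; apply: contra np => /avoids_front[].
Qed.

Lemma extensions_walks (R : comNzRingType) (k n : nat) (p : 'S_n) (s : seq nat) :
  avoids p (pattern_q 4) -> state p s ->
  (extensions k p)%:R = walks k (fun=> 1 : R) s.
Proof.
elim: k n p s => [|k IHk] n p s av st /=; first by rewrite av.
have [s0 sn act bd] := st.
(* The reversal passes from the inserted value [a] to the height [h = n - a]; heights above [sumn s]
   contribute zero. *)
rewrite movesE // big_map natr_sum (reindex_inj rev_ord_inj).
have -> : iota 0 (sumn s).+1 = index_iota 0 (sumn s).+1 by rewrite /index_iota subn0.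
transitivity (\sum_(h < n.+1 | (h <= sumn s)%N) walks k (fun=> 1 : R) (move_to s h)).
  rewrite [RHS]big_mkcond; apply: eq_bigr => h _.
  have hn : (n - rev_ord h = h)%N by have := ltn_ord h; rewrite /=; lia.
  case: ifP => hs.
    rewrite -[in RHS]hn; apply: IHk; last by apply: state_front; rewrite // hn.
    by apply/avoids_front; split=> //; apply/act; have := ltn_ord h; rewrite /=; lia.
  rewrite extensions_contains //; apply/negP => /avoids_front[_].
  by move=> /act -/(_ _); have := ltn_ord h; rewrite /=; lia.
rewrite -(big_mkord (fun h => h <= sumn s)%N (fun h => walks k (fun=> 1 : R) (move_to s h))).
by rewrite [RHS](big_nat_widen _ _ n.+1).
Qed.

Lemma num_avoiders_1342 (R : comNzRingType) (n : nat) :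
  (num_avoiders (pattern_q 4) n)%:R = walks n (fun=> 1 : R) [::].
Proof.
rewrite -[n in LHS]add0n -sum_extensions.
rewrite (big_pred1 1%g) => [|p]; last first.
  by apply/esym/eqP/permP => -[].
apply: extensions_walks.
  by apply/containsP => -[f]; case: (f ord0).
split=> // [v|h].
  rewrite leqn0 => /eqP ->; split=> // _ [f]; by case: (f ord0).
rewrite leqn0 => /eqP ->; split=> // _ []; by [].
Qed.

(** * Upper bound for prefixed patterns *)

Lemma rank_inj (n : nat) (S : {set 'I_n}) :
  {in S &, injective (fun v : 'I_n => #|[set u in S | (u < v)%N]|)}.
Proof.
move=> v v' vS v'S /= e; apply/eqP; apply/negPn/negP => vv'.
wlog lt_vv' : v v' vS v'S e vv' / (v < v')%N => [wl|].
  have [lt|lt|/val_inj eq] := ltngtP v v'; first exact: (wl v v').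
    by apply: (wl v' v) => //; rewrite eq_sym.
  by rewrite eq eqxx in vv'.
have : [set u in S | (u < v)%N] \proper [set u in S | (u < v')%N].
  apply/properP; split.
    by apply/fintype.subsetP => u; rewrite !inE => /andP[-> /ltn_trans]; exact.
  by exists v; rewrite !inE ?ltnn ?andbF // vS.
by move=> /proper_card; rewrite e ltnn.
Qed.

(** The rank of [p i] within the image of [D] is the number of positions of [D] with a smaller
    value, which depends only on the order. *)
Lemma order_uniq (n : nat) (p p' : 'S_n) (D : {set 'I_n}) :
  {in D &, forall i j, (p i < p j)%N = (p' i < p' j)%N} ->
  p @: D = p' @: D -> {in D, p =1 p'}.
Proof.
move=> ord im i iD.
have rankE (s : 'S_n) : #|[set u in s @: D | (u < s i)%N]| = #|[set j in D | (s j < s i)%N]|.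
  rewrite -[RHS](card_imset _ (@perm_inj _ s)); apply: eq_card => u.
  apply/idP/imsetP => [|[j]]; rewrite inE.
    by move=> /andP[/imsetP[j jD ->] ji]; exists j; rewrite // inE jD.
  by move=> /andP[jD ji] ->; rewrite inE imset_f.
apply: (@rank_inj _ (p @: D)); rewrite ?imset_f //; first by rewrite im imset_f.
rewrite rankE [in RHS]im rankE; apply: eq_card => j; rewrite !inE.
by case jD: (j \in D) => //=; rewrite ord.
Qed.

Lemma enum_val_ltn (n : nat) (A : {set 'I_n}) (x y : 'I_#|A|) :
  (x < y)%N -> (enum_val x < enum_val y)%N.
Proof.
move=> xy; have x0 : 'I_n := enum_val x.
rewrite !(enum_val_nth x0); pose lt_ord := [rel i j : 'I_n | (i < j)%N].
have lt_trans_ord : transitive lt_ord by move=> ? ? ? /=; exact: ltn_trans.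
apply: (@sorted_ltn_nth _ lt_ord) => //; rewrite ?inE -?cardE //.
rewrite {1}/enum_mem; apply: sorted_filter => //; rewrite -enumT.
by rewrite -(@sorted_map _ _ val ltn (enum 'I_n)) val_enum_ord iota_ltn_sorted.
Qed.

(** * Standardization: each entry is replaced by the number of smaller entries *)

Lemma standardize_lt (m : nat) (w : 'I_m -> nat) (i : 'I_m) :
  (#|[set j | (w j < w i)%N]| < m)%N.
Proof.
rewrite -[m in X in (_ < X)%N]card_ord -cardsT; apply: proper_card.
by apply/properP; split; [apply/fintype.subsetP|exists i; rewrite inE ?ltnn].
Qed.

Lemma standardize_ltn (m : nat) (w : 'I_m -> nat) (i j : 'I_m) :
  (#|[set k | (w k < w i)%N]| < #|[set k | (w k < w j)%N]|)%N = (w i < w j)%N.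
Proof.
have mono a b : (w a <= w b)%N -> (#|[set k | (w k < w a)%N]| <= #|[set k | (w k < w b)%N]|)%N.
  move=> ab; apply: subset_leq_card; apply/fintype.subsetP => k.
  by rewrite !inE => /leq_trans; exact.
apply/idP/idP => [|ij]; first by apply: contraTT; rewrite -!leqNgt => /mono.
apply: proper_card; apply/properP; split.
  by apply/fintype.subsetP => k; rewrite !inE => /ltn_trans; exact.
by exists i; rewrite !inE ?ltnn.
Qed.

Lemma standardize_inj (m : nat) (w : 'I_m -> nat) : injective w ->
  injective (fun i => Ordinal (standardize_lt w i)).
Proof.
move=> w_inj i j /(congr1 val) /= e; apply: w_inj.
have [lt|lt|//] := ltngtP (w i) (w j).
  by have := standardize_ltn w i j; rewrite lt e ltnn.
by have := standardize_ltn w j i; rewrite lt e ltnn.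
Qed.

Definition standardize (m : nat) (w : 'I_m -> nat) (w_inj : injective w) : 'S_m :=
  perm (standardize_inj w_inj).

Lemma standardizeE (m : nat) (w : 'I_m -> nat) (w_inj : injective w) i j :
  (standardize w_inj i < standardize w_inj j)%N = (w i < w j)%N.
Proof. by rewrite !permE /= standardize_ltn. Qed.

Definition lr_minima (n : nat) (p : 'S_n) : {set 'I_n} :=
  [set i : 'I_n | [forall j : 'I_n, (j < i)%N ==> (p i < p j)%N]].

(** The first entry of the occurrence is preceded by a smaller entry, which can be prepended. *)
Lemma occurs_not_lr_minima (n k : nat) (r : 'S_k) (p : 'S_n) :
  occurs (front r) (value p) [pred i | i \notin lr_minima p] ->
  contains p (front (front r)).
Proof.
move=> /occurs_front[i /= iP occ]; move: iP; rewrite inE => /forallPn[j].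
rewrite negb_imply -leqNgt (leq_eqVlt (p j)) => /andP[ji /orP[/eqP /val_inj/perm_inj e|pji]].
  by rewrite e ltnn in ji.
apply/containsP/occurs_front; exists j => //; apply/occurs_front.
exists i; first by rewrite /= ji.
move: occ; apply: occurs_sub => l /= /and3P[_ il pil].
by rewrite il (ltn_trans ji il) (ltn_trans pji pil).
Qed.

(** Standardizing the entries off [P] is injective here: the minima decrease, so [P] and [V]
    determine them, and the other entries are determined by their order and by the complement of
    [V]. *)
Lemma card_lr_fiber (n k : nat) (r : 'S_k) (P V : {set 'I_n}) :
  (#|[set p : 'S_n | [&& avoids p (front (front r)), lr_minima p == P & p @: P == V]]|
    <= num_avoiders (front r) #|~: P|)%N.
Proof.
pose w (p : 'S_n) (x : 'I_#|~: P|) := value p (enum_val x).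
have w_inj p : injective (w p).
  by move=> x y /val_inj /perm_inj /enum_val_inj.
pose phi p := standardize (@w_inj p).
rewrite -(card_in_imset (f := phi)) /num_avoiders.
  apply: subset_leq_card; apply/fintype.subsetP => _ /imsetP[p + ->].
  rewrite !inE => /and3P[avp /eqP lrP _]; apply: contra avp => /containsP occ.
  apply: occurs_not_lr_minima; move: occ.
  apply: (@occurs_map _ _ _ _ _ _ _ _ enum_val) => [x y _ _|x y _ _|x _].
  - exact: enum_val_ltn.
  - exact: standardizeE.
  - by have := enum_valP x; rewrite /= inE lrP.
move=> p p'; rewrite !inE => /and3P[_ /eqP lrP /eqP imP] /and3P[_ /eqP lrP' /eqP imP'] e.
have decr (s : 'S_n) : lr_minima s = P -> {in P &, forall i j, (s i < s j)%N = (j < i)%N}.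
  move=> sP i j; rewrite -sP !inE => /forallP lri /forallP lrj.
  have [ji|ij|/val_inj ->] := ltngtP j i; last by rewrite ltnn.
    exact: (implyP (lri j)).
  by have := implyP (lrj i) ij; lia.
apply/permP => i; have [iP|iP] := boolP (i \in P).
  apply: (@order_uniq _ p p' P) => //; last by rewrite imP imP'.
  by move=> a b aP bP; rewrite (decr p) // (decr p').
apply: (@order_uniq _ p p' (~: P)); rewrite ?inE //.
  move=> a b; rewrite -[a \in _]/(a \in ~: P) => aP bP.
  have := @standardizeE _ _ (@w_inj p) (enum_rank_in aP a) (enum_rank_in aP b).
  have := @standardizeE _ _ (@w_inj p') (enum_rank_in aP a) (enum_rank_in aP b).
  rewrite -/(phi p) -/(phi p') e => ->.
  by rewrite /w !enum_rankK_in.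
have imC (s : 'S_n) : s @: (~: P) = ~: (s @: P).
  by apply/finset.setP => u; rewrite inE -[u](permKV s) !(mem_imset _ _ (@perm_inj _ s)) inE.
by rewrite !imC imP imP'.
Qed.

Lemma sum_subsets (R : comNzRingType) (n : nat) (y : R) :
  \sum_(P : {set 'I_n}) y ^+ #|~: P| = (1 + y) ^+ n.
Proof.
rewrite (reindex_inj (inv_inj (@finset.setCK _))) /=.
rewrite (partition_big (fun P : {set 'I_n} => inord #|P| : 'I_n.+1) predT) //=.
rewrite exprDn; apply: eq_bigr => i _.
rewrite expr1n mul1r (eq_bigl (fun P : {set 'I_n} => #|P| == i)); last first.
  move=> P; apply/eqP/eqP => [<-|Pi].
    by rewrite inordK // ltnS -[n in X in (_ <= X)%N]card_ord max_card.
  by apply: val_inj; rewrite /= inordK Pi.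
rewrite (eq_bigr (fun=> y ^+ i)); last by move=> P /eqP <-; rewrite finset.setCK.
by rewrite sumr_const; have := card_draws 'I_n i; rewrite card_ord cardsE => <-.
Qed.

(** Sum the fiber bound over the positions [P] and the values [V] of the minima. For [|V| = |P|] it
    is the product of [y^|~: P|] and [y^|~: V|], so the double sum is at most the square of
    [(1 + y)^n]. *)
Lemma num_avoiders_front_le (R : realDomainType) (k : nat) (r : 'S_k) (y : R) (n : nat) :
  0 <= y -> (forall m, (num_avoiders (front r) m)%:R <= y ^+ 2 ^+ m) ->
  (num_avoiders (front (front r)) n)%:R <= (1 + y) ^+ 2 ^+ n.
Proof.
move=> y0 bound; rewrite /num_avoiders -sum1_card natr_sum.
rewrite (partition_big (@lr_minima n) predT) //= exprAC -sum_subsets expr2 mulr_suml.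
apply: ler_sum => P _; rewrite mulr_sumr.
rewrite (partition_big (fun p : 'S_n => p @: P) predT) //=.
apply: ler_sum => V _.
rewrite -natr_sum sum1dep_card.
have [PV|PV] := eqVneq #|V| #|P|; last first.
  rewrite (eq_card0 (A := _)) ?mulr_ge0 ?exprn_ge0 // => p; rewrite !inE.
  apply/negP => /andP[_ /eqP e]; case/eqP: PV.
  by rewrite -e card_imset //; exact: perm_inj.
have -> : #|~: V| = #|~: P| by rewrite (cardsCs (~: V)) (cardsCs (~: P)) !finset.setCK PV.
rewrite -expr2 exprAC; apply: le_trans (bound _); rewrite ler_nat.
apply: leq_trans (card_lr_fiber r P V); apply: subset_leq_card.
by apply/fintype.subsetP => p; rewrite !inE => /andP[/andP[-> ->] ->].
Qed.

(** * Lower bound for prefixed patterns *)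

Lemma card_ord_below (M c : nat) : (c <= M)%N -> #|[set y : 'I_M | (y < c)%N]| = c.
Proof.
move=> cM; rewrite -sum1dep_card -(big_ord_widen_cond M predT (fun=> 1%N)) //.
by rewrite sum1_card card_ord.
Qed.

(* Stably moves the elements of [A] to the end of the window [lo, lo + N). *)
Definition shuffle_key (M lo N : nat) (A : {set 'I_M}) (x : 'I_M) : nat :=
  (if x < lo then x : nat else if x < lo + N then x + N * (x \in A) else x + N)%N.

Lemma shuffle_key_inj (M lo N : nat) (A : {set 'I_M}) : injective (@shuffle_key M lo N A).
Proof.
move=> x y; rewrite /shuffle_key => e; apply: val_inj => /=; move: e.
by do 4?case: ifP; case: (x \in A); case: (y \in A) => /=; rewrite ?muln0 ?muln1; lia.
Qed.

Definition shuffle (M lo N : nat) (A : {set 'I_M}) : 'S_M :=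
  standardize (@shuffle_key_inj M lo N A).

Definition window (M lo N : nat) : {set 'I_M} := [set x : 'I_M | (lo <= x < lo + N)%N].

Lemma card_window (M lo N : nat) : (lo + N <= M)%N -> #|window M lo N| = N.
Proof.
move=> NM.
have -> : window M lo N = [set y : 'I_M | (y < lo + N)%N] :\: [set y : 'I_M | (y < lo)%N].
  by apply/finset.setP => y; rewrite !inE -leqNgt.
rewrite cardsDS ?card_ord_below ?addKn //; first by lia.
by apply/fintype.subsetP => y; rewrite !inE => ylo; apply: leq_trans ylo _; exact: leq_addr.
Qed.

Lemma shuffleE (M lo N : nat) (A : {set 'I_M}) (x y : 'I_M) :
  (shuffle lo N A x < shuffle lo N A y)%N =
  (shuffle_key lo N A x < shuffle_key lo N A y)%N.
Proof. exact: standardizeE. Qed.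

Lemma shuffle_out (M lo N : nat) (A : {set 'I_M}) (x : 'I_M) :
  x \notin window M lo N -> shuffle lo N A x = x.
Proof.
rewrite inE => xw; apply: val_inj; rewrite permE /=.
rewrite -[RHS](@card_ord_below M) ?(ltnW (ltn_ord x)) //; apply: eq_card => y.
rewrite !inE /shuffle_key; move: xw; case: (y \in A); rewrite ?muln0 ?muln1;
  by do 4?case: ifP; lia.
Qed.

Lemma shuffle_in (M lo N : nat) (A : {set 'I_M}) (x : 'I_M) :
  (lo + N <= M)%N -> A \subset window M lo N -> x \in window M lo N ->
  [/\ (lo <= shuffle lo N A x < lo + N)%N &
      (x \in A) = (lo + N - #|A| <= shuffle lo N A x)%N].
Proof.
move=> NM /fintype.subsetP AW xW.
have cardW := card_window NM.
have AN : (#|A| <= N)%N.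
  by rewrite -cardW; apply: subset_leq_card; apply/fintype.subsetP.
have cardB : #|[set y : 'I_M | (y < lo + N)%N] :\: A| = (lo + N - #|A|)%N.
  rewrite cardsDS ?card_ord_below //; apply/fintype.subsetP => y /AW.
  by rewrite !inE; lia.
have rank : shuffle lo N A x =
    #|[set y | (shuffle_key lo N A y < shuffle_key lo N A x)%N]| :> nat by rewrite permE.
have xW' : (lo <= x < lo + N)%N by rewrite inE in xW.
have r1 : (lo <= shuffle lo N A x)%N.
  rewrite rank -[X in (X <= _)%N](@card_ord_below M); last by lia.
  apply: subset_leq_card; apply/fintype.subsetP => y; rewrite !inE /shuffle_key.
  by case: (x \in A); rewrite ?muln0 ?muln1; do 4?case: ifP; lia.
have r2 : (shuffle lo N A x < lo + N)%N.
  rewrite rank -[X in (_ < X)%N](@card_ord_below M) //; apply: proper_card.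
  apply/properP; split.
    apply/fintype.subsetP => y; rewrite !inE /shuffle_key.
    by case: (x \in A); case: (y \in A); rewrite ?muln0 ?muln1; do 4?case: ifP; lia.
  by exists x; rewrite !inE ?ltnn //; lia.
split; first by rewrite r1 r2.
rewrite -cardB rank; have [xA|xA] := boolP (x \in A).
  apply/esym/subset_leq_card/fintype.subsetP => y; rewrite !inE /shuffle_key xA.
  by case: (y \in A); rewrite /= ?muln0 ?muln1 //; do 4?case: ifP; lia.
apply/esym/negbTE; rewrite -ltnNge; apply: proper_card; apply/properP; split.
  apply/fintype.subsetP => y; rewrite !inE /shuffle_key (negPf xA).
  have := AW y; rewrite inE.
  by case: (y \in A) => [/(_ isT)|_]; rewrite /= ?muln0 ?muln1 //; do 4?case: ifP; lia.
by exists x; rewrite !inE ?ltnn //= xA; lia.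
Qed.

(** * Gluing a block onto a permutation *)

(** Reading [p] on natural numbers, with the identity beyond [n], avoids casts between the ordinals
    of the blocks. *)
Definition perm_nat (n : nat) (p : 'S_n) (x : nat) : nat :=
  if insub x is Some y then p y else x.

Lemma perm_natE (n : nat) (p : 'S_n) (y : 'I_n) : perm_nat p y = p y.
Proof. by rewrite /perm_nat valK. Qed.

Lemma perm_nat_lt (n : nat) (p : 'S_n) x : (x < n)%N -> (perm_nat p x < n)%N.
Proof. by move=> xn; rewrite -[x]/(nat_of_ord (Ordinal xn)) perm_natE. Qed.

Lemma perm_nat_inj (n : nat) (p : 'S_n) x y :
  (x < n)%N -> (y < n)%N -> perm_nat p x = perm_nat p y -> x = y.
Proof.
move=> xn yn; rewrite -[x]/(nat_of_ord (Ordinal xn)) -[y]/(nat_of_ord (Ordinal yn)).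
by rewrite !perm_natE => /val_inj /perm_inj [].
Qed.

(** The skew sum of [b], a decreasing sequence of length [i], and [p], before any shuffling. *)
Definition base_fun (l i n : nat) (b : 'S_l) (p : 'S_n) (s : nat) : nat :=
  (if s < l then n + i + perm_nat b s
   else if s < l + i then n + i - (s - l).+1 else perm_nat p (s - (l + i)))%N.

Lemma base_lt (l i n : nat) (b : 'S_l) (p : 'S_n) (s : 'I_(l + i + n)) :
  (base_fun i b p s < l + i + n)%N.
Proof.
rewrite /base_fun; have sM := ltn_ord s.
case: ifP => sl; first by have := perm_nat_lt b sl; lia.
case: ifP => sN; first by lia.
have sn : (s - (l + i) < n)%N by lia.
by have := perm_nat_lt p sn; lia.
Qed.

Lemma base_inj (l i n : nat) (b : 'S_l) (p : 'S_n) :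
  injective (fun s : 'I_(l + i + n) => Ordinal (base_lt b p s)).
Proof.
move=> s t /(congr1 val) /= e; apply: val_inj => /=; move: e (ltn_ord s) (ltn_ord t).
rewrite /base_fun; have lt1 x := @perm_nat_lt _ b x; have lt2 x := @perm_nat_lt _ p x.
have := lt1 s; have := lt1 t; have := lt2 (s - (l + i))%N; have := lt2 (t - (l + i))%N.
case: ifP => sl; case: ifP => tl; do 2?case: ifP => ?; try by lia.
  by move=> _ _ _ _ e _ _; apply: (@perm_nat_inj _ b) => //; lia.
move=> _ _ _ _ e ? ?; suff : (s - (l + i) = t - (l + i))%N by lia.
by apply: (@perm_nat_inj _ p) => //; lia.
Qed.

Definition base (l i n : nat) (b : 'S_l) (p : 'S_n) : 'S_(l + i + n) :=
  perm (@base_inj l i n b p).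

Lemma baseE (l i n : nat) (b : 'S_l) (p : 'S_n) s :
  @base l i n b p s = base_fun i b p s :> nat.
Proof. by rewrite permE. Qed.


Lemma shuffle_low (M lo N : nat) (A : {set 'I_M}) (x : 'I_M) :
  (lo + N <= M)%N -> A \subset window M lo N ->
  (shuffle lo N A x < lo + N - #|A|)%N ->
  shuffle_key lo N A x = x /\ (x < lo + N)%N.
Proof.
move=> NM AW lt; rewrite /shuffle_key.
have [xW|xW] := boolP (x \in window M lo N).
  have [_] := shuffle_in NM AW xW; rewrite leqNgt lt /= => ->.
  have /andP[_ xN] : (lo <= x < lo + N)%N by rewrite inE in xW.
  by rewrite xN muln0 addn0; case: ifP.
by move: lt (xW); rewrite (shuffle_out _ xW) inE; do 2?case: ifP; lia.
Qed.

Lemma shuffle_mid (M lo N : nat) (A : {set 'I_M}) (x : 'I_M) :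
  (lo + N <= M)%N -> A \subset window M lo N ->
  (lo + N - #|A| <= shuffle lo N A x < lo + N)%N = (x \in A).
Proof.
move=> NM AW; have [xW|xW] := boolP (x \in window M lo N).
  by have [/andP[_ ->] ->] := shuffle_in NM AW xW; rewrite andbT.
rewrite shuffle_out //; apply/idP/idP => [h|xA].
  have AN : (#|A| <= N)%N.
    by rewrite -[X in (_ <= X)%N](card_window NM); exact: subset_leq_card.
  by move: h xW; rewrite inE; lia.
by move/fintype.subsetP: AW => /(_ _ xA) e; rewrite e in xW.
Qed.

Lemma shuffle_high (M lo N : nat) (A : {set 'I_M}) (x : 'I_M) :
  (lo + N <= M)%N -> A \subset window M lo N ->
  (lo + N <= shuffle lo N A x)%N -> shuffle lo N A x = x.
Proof.
move=> NM AW h; have [xW|] := boolP (x \in window M lo N); last exact: shuffle_out.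
by have [/andP[_]] := shuffle_in NM AW xW; rewrite ltnNge h.
Qed.

(* [b] sits above and to the left of [p]; among the first [l + i] positions, those in
   [A] carry a decreasing sequence, whose set of values is [B]. *)
Definition glue (l i n : nat) (A B : {set 'I_(l + i + n)}) (b : 'S_l) (p : 'S_n) :
    'S_(l + i + n) :=
  (shuffle 0 (l + i) A * @base l i n b p * (shuffle (n - l) (l + i) B)^-1)%g.

(** The value window [[n - l, n + i)] holds the [l] largest values of [p] and the [i] values of the
    decreasing sequence. *)
Definition glue_data (l i n : nat) (A B : {set 'I_(l + i + n)}) : Prop :=
  [/\ A \subset window (l + i + n) 0 (l + i), #|A| = i,
      B \subset window (l + i + n) (n - l) (l + i), #|B| = i & (l <= n)%N].

Lemma glueK (l i n : nat) (A B : {set 'I_(l + i + n)}) (b : 'S_l) (p : 'S_n)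
    (u : 'I_(l + i + n)) :
  shuffle (n - l) (l + i) B (glue A B b p u) = @base l i n b p (shuffle 0 (l + i) A u).
Proof. by rewrite !permM permKV. Qed.

Lemma glue_top (l i n : nat) (A B : {set 'I_(l + i + n)}) (b : 'S_l) (p : 'S_n)
    (u : 'I_(l + i + n)) :
  glue_data A B -> (u < l + i)%N -> u \notin A ->
  [/\ (shuffle 0 (l + i) A u < l)%N, shuffle_key 0 (l + i) A u = u &
      glue A B b p u = n + i + perm_nat b (shuffle 0 (l + i) A u) :> nat]%N.
Proof.
move=> [AW cA BW cB ln] ul uA.
have uW : u \in window (l + i + n) 0 (l + i) by rewrite inE.
have [] := shuffle_in (_ : (0 + (l + i) <= l + i + n)%N) AW uW; first by rewrite leq_addr.
rewrite (negPf uA) cA => /andP[_ _] /esym/negbT; rewrite -ltnNge => cu.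
have {}cu : (shuffle 0 (l + i) A u < l)%N by lia.
split=> //; first by rewrite /shuffle_key (negPf uA) muln0 addn0 ul.
have e := glueK A B b p u.
have eb : @base l i n b p (shuffle 0 (l + i) A u) =
    (n + i + perm_nat b (shuffle 0 (l + i) A u))%N :> nat by rewrite baseE /base_fun cu.
rewrite -eb -e shuffle_high // ?e ?eb; lia.
Qed.

Lemma glue_mid (l i n : nat) (A B : {set 'I_(l + i + n)}) (b : 'S_l) (p : 'S_n)
    (u : 'I_(l + i + n)) :
  glue_data A B -> u \in A ->
  [/\ (u < l + i)%N, (l <= shuffle 0 (l + i) A u < l + i)%N,
      shuffle (n - l) (l + i) B (glue A B b p u) =
        n + i - (shuffle 0 (l + i) A u - l).+1 :> nat & glue A B b p u \in B]%N.
Proof.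
move=> [AW cA BW cB ln] uA.
have uW := fintype.subsetP AW _ uA.
have := shuffle_mid u (_ : (0 + (l + i) <= l + i + n)%N) AW; rewrite uA cA leq_addr => /(_ isT).
have -> : (0 + (l + i) - i = l)%N by lia.
move=> cu; have e := glueK A B b p u.
have eb : shuffle (n - l) (l + i) B (glue A B b p u) =
        (n + i - (shuffle 0 (l + i) A u - l).+1)%N :> nat.
  by rewrite e baseE /base_fun; do 2?case: ifP; lia.
split=> //; first by rewrite inE in uW.
by rewrite -(@shuffle_mid _ (n - l) (l + i)) ?cB ?eb //; lia.
Qed.

Lemma glue_low (l i n : nat) (A B : {set 'I_(l + i + n)}) (b : 'S_l) (p : 'S_n)
    (u : 'I_(l + i + n)) :
  glue_data A B -> (l + i <= u)%N ->
  [/\ shuffle (n - l) (l + i) B (glue A B b p u) = perm_nat p (u - (l + i)) :> nat,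
      shuffle_key (n - l) (l + i) B (glue A B b p u) = glue A B b p u,
      (glue A B b p u < n + i)%N &
      (n - l <= glue A B b p u)%N = (n - l <= perm_nat p (u - (l + i)))%N].
Proof.
move=> [AW cA BW cB ln] lu.
have cu : shuffle 0 (l + i) A u = u by apply: shuffle_out; rewrite inE; lia.
have e := glueK A B b p u.
have eb : shuffle (n - l) (l + i) B (glue A B b p u) = perm_nat p (u - (l + i)) :> nat.
  by rewrite e cu baseE /base_fun; do 2?case: ifP; lia.
have un : (u - (l + i) < n)%N by have := ltn_ord u; lia.
have pn := perm_nat_lt p un.
have NM : (n - l + (l + i) <= l + i + n)%N by lia.
have [k1 k2] := @shuffle_low _ _ _ _ (glue A B b p u) NM BW (ltac:(rewrite cB eb; lia)).
split=> //; first by lia.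
have [gW|gW] := boolP (glue A B b p u \in window (l + i + n) (n - l) (l + i)).
  have [/andP[h _] _] := shuffle_in NM BW gW.
  by rewrite -eb h; move: gW; rewrite inE => /andP[-> _].
by rewrite -eb shuffle_out.
Qed.

Lemma perm_nat_ord (n : nat) (p : 'S_n) x (xn : (x < n)%N) :
  perm_nat p x = p (Ordinal xn).
Proof. by rewrite -perm_natE. Qed.

(** Version of [occurs_map] for a map defined on [A] only: membership supplies the bound of the
    target ordinal. *)
Lemma occurs_map_dep (n m k : nat) (q : 'S_k) (w : 'I_n -> nat) (w' : 'I_m -> nat)
    (A : pred 'I_n) (B : pred 'I_m) (g : forall x, A x -> 'I_m) :
  (forall (x y : 'I_n) (Ax : A x) (Ay : A y), (x < y)%N -> (g x Ax < g y Ay)%N) ->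
  (forall x y Ax Ay, (w x < w y)%N = (w' (g x Ax) < w' (g y Ay))%N) ->
  (forall x Ax, B (g x Ax)) ->
  occurs q w A -> occurs q w' B.
Proof.
move=> gmono gord gB [f [f1 f2 f3]]; exists (fun a => g (f a) (f3 a)).
split=> [a b ab|a b|a]; [exact/gmono/f1|by rewrite -gord f2|exact: gB].
Qed.

Lemma glue_occurs_top (l i n k : nat) (q : 'S_k) (A B : {set 'I_(l + i + n)})
    (b : 'S_l) (p : 'S_n) (S : pred 'I_(l + i + n)) :
  glue_data A B -> (forall u : 'I_(l + i + n), S u -> (u < l + i)%N /\ u \notin A) ->
  occurs q (value (glue A B b p)) S -> occurs q (value b) predT.
Proof.
move=> AB Stop; have top u (Su : S u) := glue_top b p AB (Stop u Su).1 (Stop u Su).2.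
have lt u (Su : S u) : (shuffle 0 (l + i) A u < l)%N by have [] := top u Su.
apply: (@occurs_map_dep _ _ _ _ _ _ _ _ (fun u Su => Ordinal (lt u Su))) => //.
  move=> x y Sx Sy xy /=; rewrite shuffleE.
  by have [_ -> _] := top x Sx; have [_ -> _] := top y Sy.
move=> x y Sx Sy; have [_ _ ex] := top x Sx; have [_ _ ey] := top y Sy.
by rewrite /value ex ey ltn_add2l (perm_nat_ord b (lt x Sx)) (perm_nat_ord b (lt y Sy)).
Qed.

Lemma glue_occurs_low (l i n k : nat) (q : 'S_k) (A B : {set 'I_(l + i + n)})
    (b : 'S_l) (p : 'S_n) (S : pred 'I_(l + i + n)) (T : pred 'I_n) :
  glue_data A B -> (forall u, S u -> (l + i <= u)%N) ->
  (forall (u : 'I_(l + i + n)) (j : 'I_n), S u -> u = (l + i + j)%N :> nat -> T j) ->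
  occurs q (value (glue A B b p)) S -> occurs q (value p) T.
Proof.
move=> AB Slow ST; have low u (Su : S u) := glue_low b p AB (Slow u Su).
have lt (u : 'I_(l + i + n)) (Su : S u) : (u - (l + i) < n)%N.
  by have := Slow u Su; have := ltn_ord u; lia.
apply: (@occurs_map_dep _ _ _ _ _ _ _ _ (fun u Su => Ordinal (lt u Su))) =>
  [x y Sx Sy xy|x y Sx Sy|x Sx] /=.
- by have := Slow x Sx; lia.
- have [ex kx _ _] := low x Sx; have [ey ky _ _] := low y Sy.
  rewrite /value -{1}kx -{1}ky -shuffleE ex ey.
  by rewrite (perm_nat_ord p (lt x Sx)) (perm_nat_ord p (lt y Sy)).
- by apply: (ST x) => //=; have := Slow x Sx; lia.
Qed.

Lemma glue_decreasing (l i n : nat) (A B : {set 'I_(l + i + n)}) (b : 'S_l) (p : 'S_n)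
    (u v : 'I_(l + i + n)) :
  glue_data A B -> u \in A -> v \in A -> (u < v)%N ->
  (glue A B b p v < glue A B b p u)%N.
Proof.
move=> AB uA vA uv; have [ul cu ru uB] := glue_mid b p AB uA.
have [vl cv rv vB] := glue_mid b p AB vA.
have cuv : (shuffle 0 (l + i) A u < shuffle 0 (l + i) A v)%N.
  by rewrite shuffleE /shuffle_key uA vA /= ul vl ltn_add2r.
have [_ _ /fintype.subsetP BW _ _] := AB.
have keyB x : x \in B -> shuffle_key (n - l) (l + i) B x = (x + (l + i))%N.
  move=> xB; have := BW x xB; rewrite inE /shuffle_key xB muln1 => /andP[h ->].
  by rewrite ltnNge h.
by rewrite -(ltn_add2r (l + i)) -!keyB // -shuffleE ru rv; lia.
Qed.

Definition top_avoids (k : nat) (q : 'S_k) (l n : nat) (p : 'S_n) : Prop :=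
  ~ occurs q (value p) [pred j | (n - l <= p j)%N].

(** The [l] largest values of the glued permutation are those of [b], so that gluing can be
    iterated. *)
Lemma glue_top_avoids (l i n k : nat) (q : 'S_k) (A B : {set 'I_(l + i + n)})
    (b : 'S_l) (p : 'S_n) :
  glue_data A B -> avoids b q -> top_avoids q l (glue A B b p).
Proof.
move=> AB /containsP avb occ; apply: avb; move: occ; apply: (glue_occurs_top AB) => u /= gu.
have [ul|lu] := ltnP u (l + i); last first.
  by have [_ _] := glue_low b p AB lu; lia.
split=> //; apply/negP => uA; have [_ _ gu' guB] := glue_mid b p AB uA.
have [_ _ /fintype.subsetP BW _ ln] := AB.
by have := BW _ guB; rewrite inE; lia.
Qed.

(** According to its first entry, an occurrence lies in [p], or its remainder lies in [b], or it
    starts in the decreasing sequence. In the last case the other entries lie in [b] or among the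
    [l] top entries of [p], and [occurs_skew] confines them to one of these two. *)
Lemma glue_avoids (l i n k : nat) (r : 'S_k) (A B : {set 'I_(l + i + n)})
    (b : 'S_l) (p : 'S_n) :
  glue_data A B -> avoids b (front r) -> avoids p (front (front r)) ->
  top_avoids (front r) l p -> avoids (glue A B b p) (front (front r)).
Proof.
move=> AB /containsP avb /containsP avp topp.
have [_ _ /fintype.subsetP BW _ ln] := AB.
set g := glue A B b p; apply/containsP => /occurs_front[u _ /= occ].
have [ul|lu] := ltnP u (l + i); last first.
  apply: avp; have un : (u - (l + i) < n)%N by have := ltn_ord u; lia.
  apply/occurs_front; exists (Ordinal un) => //; move: occ.
  apply: (glue_occurs_low AB) => [v /andP[uv _]|v j /andP[uv guv] vj]; first by lia.
  have lv : (l + i <= v)%N by lia.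
  have [eu ku _ _] := glue_low b p AB lu; have [ev kv _ _] := glue_low b p AB lv.
  have e : perm_nat p (v - (l + i)) = p j by rewrite vj addKn perm_natE.
  have eu' := perm_nat_ord p un.
  rewrite /= /value -e -eu' -eu -ev shuffleE ku kv guv andbT; lia.
have [uA|uA] := boolP (u \in A); last first.
  have [_ _ eu] := glue_top b p AB ul uA.
  apply: avb; move: occ; apply: (glue_occurs_top AB) => v /andP[_]; rewrite /value eu => gv.
  have [vl|lv] := ltnP v (l + i); last by have [_ _] := glue_low b p AB lv; rewrite -/g; lia.
  split=> //; apply/negP => vA; have [_ _ _ guB] := glue_mid b p AB vA.
  by have := BW _ guB; rewrite inE -/g; lia.
have [_ _ _ guB] := glue_mid b p AB uA.
have nlu : (n - l <= g u)%N by have := BW _ guB; rewrite inE -/g; lia.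
have notA (v : 'I_(l + i + n)) : (u < v)%N && (value g u < value g v)%N -> v \notin A.
  move=> /andP[uv guv]; apply/negP => vA.
  by have := glue_decreasing b p AB uA vA uv; rewrite -/g; move: guv; rewrite /value; lia.
have [] := occurs_skew (B := [pred v : 'I_(l + i + n) | (v < l + i)%N]) _ occ.
- move=> v w hv hw /= vl; rewrite -leqNgt => lw; apply/andP; split; first by lia.
  have [_ _ ev] := glue_top b p AB vl (notA v hv).
  by have [_ _ + _] := glue_low b p AB lw; rewrite /value /g ev; lia.
- move=> occ'; apply: avb; move: occ'; apply: (glue_occurs_top AB) => v /andP[hv vl].
  by split=> //; exact: notA.
- move=> occ'; apply: topp; move: occ'.
  apply: (glue_occurs_low AB) => [v /andP[_]|v j /andP[/andP[_ guv] /= lv] vj].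
    by rewrite /= -leqNgt.
  have lv' : (l + i <= v)%N by rewrite leqNgt.
  have e : perm_nat p (v - (l + i)) = p j by rewrite vj addKn perm_natE.
  have [_ _ _ +] := glue_low b p AB lv'; rewrite e /= => <-.
  by move: guv; rewrite /value -/g; lia.
Qed.

(** [A] consists of the positions below [l + i] with values below [n + i], and [B] is its image. The
    shuffles are then known and cancel, leaving [base]. *)
Lemma glue_inj (l i n : nat) (A B A' B' : {set 'I_(l + i + n)}) (b b' : 'S_l) (p p' : 'S_n) :
  glue_data A B -> glue_data A' B' -> glue A B b p = glue A' B' b' p' ->
  [/\ A = A', B = B', b = b' & p = p'].
Proof.
move=> AB AB' e.
have decode (X Y : {set 'I_(l + i + n)}) (c : 'S_l) (s : 'S_n) : glue_data X Y ->
    X = [set u : 'I_(l + i + n) | (u < l + i)%N && (glue X Y c s u < n + i)%N]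
    /\ Y = glue X Y c s @: X.
  move=> XY; have [XW cX YW cY ln] := XY; split.
    apply/finset.setP => u; rewrite inE; have [uX|uX] := boolP (u \in X).
      have [-> _ _ /(fintype.subsetP YW)] := glue_mid c s XY uX.
      by rewrite inE /=; lia.
    have [ul|//] := boolP (u < l + i)%N.
    by have [_ _ ->] := glue_top c s XY ul uX; rewrite -addnA ltn_add2l; lia.
  apply/esym/eqP; rewrite eqEcard card_imset ?cX ?cY ?leqnn ?andbT; last exact: perm_inj.
  by apply/fintype.subsetP => _ /imsetP[u uX ->]; have [] := glue_mid c s XY uX.
have [eA eB] := decode _ _ b p AB; have [eA' eB'] := decode _ _ b' p' AB'.
have AA' : A = A' by rewrite eA eA' e.
have BB' : B = B' by rewrite eB eB' e AA'.
have eb : base i b p = base i b' p'.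
  by move: e; rewrite /glue AA' BB' => /mulIg /mulgI.
have eval s : (s < l + i + n)%N -> base_fun i b p s = base_fun i b' p' s.
  move=> sM; have := congr1 (fun t : 'S_(l + i + n) => nat_of_ord (t (Ordinal sM))) eb.
  by rewrite !baseE.
split=> //; apply/permP => s; apply: val_inj => /=; have sl := ltn_ord s.
  have := eval s; rewrite /base_fun sl !perm_natE => /(_ _)/addnI; apply; lia.
have := eval (l + i + s)%N; rewrite /base_fun ltn_add2l sl => /(_ isT).
have -> : (l + i + s < l = false)%N by lia.
have -> : (l + i + s < l + i = false)%N by lia.
by rewrite addKn !perm_natE.
Qed.

Definition good_perms (k : nat) (q : 'S_k) (l n : nat) : {set 'S_n} :=
  [set p | avoids p (front q) && `[< top_avoids q l p >]].

Lemma card_good_perms (k : nat) (r : 'S_k) (l i n : nat) : (l <= n)%N ->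
  ('C(l + i, i) ^ 2 * num_avoiders (front r) l * #|good_perms (front r) l n|
   <= #|good_perms (front r) l (l + i + n)|)%N.
Proof.
move=> ln; pose draws lo := [set A : {set 'I_(l + i + n)} |
  A \subset window (l + i + n) lo (l + i) & #|A| == i].
have card_draws_window lo : (lo + (l + i) <= l + i + n)%N -> #|draws lo| = 'C(l + i, i).
  by move=> h; rewrite /draws cards_draws card_window.
pose X := finset.setX (finset.setX (draws 0%N) (draws (n - l)%N))
  (finset.setX [set b : 'S_l | avoids b (front r)] (good_perms (front r) l n)).
pose g (x : ({set 'I_(l + i + n)} * {set 'I_(l + i + n)}) * ('S_l * 'S_n)) :=
  glue x.1.1 x.1.2 x.2.1 x.2.2.
have -> : ('C(l + i, i) ^ 2 * num_avoiders (front r) l * #|good_perms (front r) l n| = #|X|)%N.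
  rewrite /X !finset.cardsX !card_draws_window; [by rewrite mulnA|lia|lia].
have XP x : x \in X -> [/\ glue_data x.1.1 x.1.2, avoids x.2.1 (front r),
    avoids x.2.2 (front (front r)) & top_avoids (front r) l x.2.2].
  case: x => [[A B] [b p]]; rewrite !inE /=.
  by move=> /andP[/andP[/andP[? /eqP ?] /andP[? /eqP ?]] /and3P[? ? /asboolP ?]].
rewrite -(card_in_imset (f := g)).
  apply: subset_leq_card; apply/fintype.subsetP => _ /imsetP[x /XP[AB avb avp topp] ->].
  by rewrite inE glue_avoids //; apply/asboolP; exact: glue_top_avoids.
move=> x y /XP[AB _ _ _] /XP[AB' _ _ _] /(glue_inj AB AB').
by case: x y {AB AB'} => [[A B] [b p]] [[A' B'] [b' p']] /= [-> -> -> ->].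
Qed.

Lemma decreasing_avoids (k : nat) (r : 'S_k) (n : nat) : (0 < k)%N ->
  avoids (perm (@rev_ord_inj n)) (front r).
Proof.
move=> k0; apply/containsP => /occurs_front[u _ [f [_ _ f3]]].
have /andP[uf] := f3 (Ordinal k0); rewrite /value !permE /=.
by have := ltn_ord (f (Ordinal k0)); lia.
Qed.

Lemma avoids_frontW (n k : nat) (p : 'S_n) (q : 'S_k) : avoids p q -> avoids p (front q).
Proof.
move=> /containsP avp; apply/containsP => /occurs_front[u _ occ]; apply: avp.
by move: occ; exact: occurs_sub.
Qed.

(** [m] blocks of length [l + i] are glued one after the other onto permutations of length [l],
    among which the decreasing one is good. *)
Lemma num_avoiders_front_blocks (k : nat) (r : 'S_k) (l i m : nat) : (0 < k)%N ->
  (('C(l + i, i) ^ 2 * num_avoiders (front r) l) ^ m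
   <= num_avoiders (front (front r)) (m * (l + i) + l))%N.
Proof.
move=> k0; apply: (@leq_trans #|good_perms (front r) l (m * (l + i) + l)|).
  elim: m => [|m IHm].
    rewrite expn0 mul0n add0n card_gt0; apply/set0Pn; exists (perm (@rev_ord_inj l)).
    rewrite inE avoids_frontW ?decreasing_avoids //; apply/asboolP => occ.
    have /containsP := decreasing_avoids r l k0; apply.
    by move: occ; exact: occurs_sub.
  rewrite mulSn -addnA; apply: leq_trans (card_good_perms _ _ _); last by rewrite leq_addl.
  by rewrite expnS leq_mul2l IHm orbT.
by apply: subset_leq_card; apply/fintype.subsetP => p; rewrite !inE => /andP[].
Qed.

(** A new maximum in front cannot start an occurrence of [front r], as no entry exceeds it. *)
Lemma num_avoiders_front_mono (k : nat) (r : 'S_k) (n m : nat) : (0 < k)%N ->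
  (n <= m)%N -> (num_avoiders (front r) n <= num_avoiders (front r) m)%N.
Proof.
move=> k0 /subnK <-; elim: (m - n)%N => [//|d IHd]; apply: leq_trans IHd _.
rewrite addSn; move: (d + n)%N => e.
rewrite /num_avoiders -(card_in_imset (f := lift_perm ord0 ord_max)) => [|p p' _ _ eq]; last first.
  apply/permP => i; have := congr1 (fun s : 'S_e.+1 => s (lift ord0 i)) eq.
  by rewrite !lift_perm_lift => /lift_inj.
apply: subset_leq_card; apply/fintype.subsetP => _ /imsetP[p + ->]; rewrite !inE.
move=> /containsP avp; apply/containsP => /occurs_front_insert[//|[f [_ _ f3]]].
by have := f3 (Ordinal k0); rewrite /= leqNgt ltn_ord.
Qed.

(** * Growth rates *)

(** Bernoulli's inequality for the fourth root [s] of [rho] bounds [n + 1] by a multiple of [s^n];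
    take fourth powers. Degree four covers the polynomial losses below and leaves room to absorb
    constants. *)
Lemma quartic_le_exp (R : realType) (rho : R) : 1 < rho ->
  exists2 K : R, 0 < K & forall n, n.+1%:R ^+ 4 <= K * rho ^+ n.
Proof.
move=> rho1; pose s := Num.sqrt (Num.sqrt rho).
have s1 : 1 < s.
  by rewrite /s -{1}(@sqrtr1 R) ltr_sqrt ?sqrtr_gt0 -1?{1}(@sqrtr1 R) ?ltr_sqrt; lra.
have s4 : s ^+ 4 = rho.
  by rewrite (exprM s 2 2) sqr_sqrtr ?sqrtr_ge0 // sqr_sqrtr //; lra.
have ds : 0 < s - 1 by rewrite subr_gt0.
have linear n : n.+1%:R <= (1 + (s - 1)^-1) * s ^+ n.
  have bern : 1 + n%:R * (s - 1) <= s ^+ n.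
    elim: n => [|n IHn]; first by rewrite mul0r addr0 expr0.
    rewrite exprSr -natr1; have n0 : 0 <= n%:R :> R by [].
    have : (1 + n%:R * (s - 1)) * s <= s ^+ n * s by rewrite ler_wpM2r //; lra.
    by apply: le_trans; have := mulr_ge0 n0 (sqr_ge0 (s - 1)); lra.
  apply: (@le_trans _ _ ((1 + (s - 1)^-1) * (1 + n%:R * (s - 1)))); last first.
    by rewrite ler_wpM2l // addr_ge0 // invr_ge0 ltW.
  have inv0 : 0 <= (s - 1)^-1 by rewrite invr_ge0 ltW.
  have -> : (1 + (s - 1)^-1) * (1 + n%:R * (s - 1)) =
      1 + n%:R + n%:R * (s - 1) + (s - 1)^-1 by field; lra.
  by rewrite -natr1; have : 0 <= n%:R * (s - 1) by [rewrite mulr_ge0 // ltW]; lra.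
exists ((1 + (s - 1)^-1) ^+ 4); first by rewrite exprn_gt0 // addr_gt0 // invr_gt0.
move=> n; rewrite -s4 exprAC -exprMn; apply: lerXn2r => //; rewrite nnegrE //.
by rewrite (le_trans _ (linear n)).
Qed.

(** [y] is the square root of the growth rate. The upper bound has constant 1, as in
    [num_avoiders_front_le], while the lower bound may lose a constant for each [c]. *)
Definition growth (R : realType) (a : nat -> nat) (y : R) : Prop :=
  (forall n, (a n)%:R <= y ^+ 2 ^+ n) /\
  (forall c, 0 < c -> c < y ^+ 2 ->
     exists2 kappa, 0 < kappa & forall n, kappa * c ^+ n <= (a n)%:R).

Lemma growth_1342 (R : realType) :
  growth (num_avoiders (pattern_q 4)) (Num.sqrt 8 : R).
Proof.
rewrite /growth sqr_sqrtr //; split=> [n|c c0 c8].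
  by rewrite num_avoiders_1342; have [] := walks_growth R n.
have [|K K0 quartic] := @quartic_le_exp R (8 / c); first by rewrite ltr_pdivlMr // mul1r.
exists (64 * K)^-1; first by rewrite invr_gt0 mulr_gt0.
move=> n; have [_] := walks_growth R n; rewrite -num_avoiders_1342.
move: ((num_avoiders _ n)%:R) => a low.
rewrite ler_pdivrMl ?mulr_gt0 //.
have n3 : 0 < n.+1%:R ^+ 3 :> R by rewrite exprn_gt0.
rewrite -(ler_pM2l n3).
have cubic : n.+1%:R ^+ 3 * c ^+ n <= K * 8 ^+ n.
  have := quartic n; rewrite expr_div_n mulrA ler_pdivlMr ?exprn_gt0 //.
  apply: le_trans; rewrite ler_pM2r ?exprn_gt0 //.
  by apply: ler_weXn2l => //; rewrite ler1n.
apply: le_trans cubic _.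
have -> : n.+1%:R ^+ 3 * (64 * K * a) = K * (64 * n.+1%:R ^+ 3 * a) by ring.
by rewrite ler_pM2l.
Qed.

Lemma binomial_term_ge (R : realType) (y : R) (N : nat) : 0 <= y ->
  exists2 i, (i <= N)%N & (1 + y) ^+ N <= N.+1%:R * ('C(N, i)%:R * y ^+ (N - i)).
Proof.
move=> y0; apply: contrapT => no.
have lt (i : 'I_N.+1) : N.+1%:R * ('C(N, i)%:R * y ^+ (N - i)) < (1 + y) ^+ N.
  by rewrite ltNge; apply/negP => le; apply: no; exists i; rewrite // -ltnS.
have : \sum_(i < N.+1) N.+1%:R * ('C(N, i)%:R * y ^+ (N - i))
    < \sum_(i < N.+1) (1 + y) ^+ N.
  by apply: ltr_sum => //; apply/hasP; exists ord0; rewrite ?mem_index_enum.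
have binom : \sum_(i < N.+1) 'C(N, i)%:R * y ^+ (N - i) = (1 + y) ^+ N.
  rewrite [1 + y]addrC exprDn; apply: eq_bigr => i _.
  by rewrite expr1n mulr1 mulr_natl.
by rewrite sumr_const card_ord -mulr_sumr binom mulr_natl ltxx.
Qed.

(** For the lower bound, a largest term of the expansion of [(1 + y')^N], with [y' < y] and [N]
    large, dictates [l] and [i] such that one block contributes at least [c^N]. Blocks are then
    repeated, and monotonicity fills the gaps between lengths. *)
Lemma growth_front (R : realType) (k : nat) (r : 'S_k) (y : R) :
  (0 < k)%N -> 0 < y -> growth (num_avoiders (front r)) y ->
  growth (num_avoiders (front (front r))) (1 + y).
Proof.
move=> k0 y0 [up low]; split=> [n|]; first by apply: num_avoiders_front_le; rewrite ?ltW.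
(* Replacing [c] by its maximum with 1 makes the powers of [c] nondecreasing. *)
suff large c : 1 <= c -> c < (1 + y) ^+ 2 -> exists2 kappa : R, 0 < kappa &
    forall n, kappa * c ^+ n <= (num_avoiders (front (front r)) n)%:R.
  move=> c c0 cy; have [||kappa kappa0 le] := large (Num.max 1 c).
  - by rewrite le_max lexx.
  - by rewrite gt_max cy andbT; nra.
  exists kappa => // n; apply: le_trans (le n); rewrite ler_wpM2l ?(ltW kappa0) //.
  by apply: lerXn2r; rewrite ?nnegrE ?le_max ?(ltW c0) ?lexx ?orbT.
move=> c1 cy; have c0 : 0 < c by lra.
pose s := Num.sqrt c; have s2 : s ^+ 2 = c by rewrite sqr_sqrtr // ltW.
have s0 : 0 <= s by rewrite sqrtr_ge0.
have s1 : 1 <= s by nra.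
have sy : s < 1 + y by nra.
(* The midpoint leaves room on both sides: [s < 1 + y'] and [y' < y]. *)
pose y' := (s - 1 + y) / 2; have y'y : y' < y by rewrite /y'; lra.
have y'0 : 0 < y' by rewrite /y'; lra.
have sy' : s < 1 + y' by rewrite /y'; lra.
have [||kappa kappa0 lowy'] := low (y' ^+ 2); [by rewrite exprn_gt0|by nra|].
have rho1 : 1 < (1 + y') ^+ 2 / c by rewrite ltr_pdivlMr // mul1r; nra.
have [K K0 quartic] := quartic_le_exp rho1.
(* So large that the gap between [c] and [(1 + y')^2] pays for [kappa] and for the square of the
   [N + 1] terms. *)
pose N := (Num.truncn (K / kappa)).+1.
have KN : K <= kappa * N.+1%:R.
  rewrite mulrC -ler_pdivrMr //; apply: le_trans (ltW (truncnS_gt _)) _.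
  by rewrite ler_nat.
have N0 : (0 < N)%N by [].
clearbody N; have big : c ^+ N * N.+1%:R ^+ 2 <= kappa * ((1 + y') ^+ N) ^+ 2.
  have := quartic N; rewrite expr_div_n mulrA ler_pdivlMr ?exprn_gt0 // => q4.
  have x1 : 1 <= N.+1%:R :> R by rewrite ler1n.
  rewrite [_ ^+ N ^+ 2]exprAC; move: q4 KN x1.
  move: (N.+1%:R) (c ^+ N) (exprn_gt0 N c0) => x e e0.
  have : 0 <= (1 + y') ^+ 2 ^+ N by rewrite exprn_ge0 ?sqr_ge0.
  move: ((1 + y') ^+ 2 ^+ N) => f f0 q4 KN x1.
  have x0 : 0 < x ^+ 2 by rewrite exprn_gt0; lra.
  rewrite -(ler_pM2l x0); apply: (@le_trans _ _ (x ^+ 4 * e)); first by lra.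
  apply: le_trans q4 _; rewrite [leRHS]mulrA ler_wpM2r //.
  by apply: le_trans KN _; rewrite mulrC ler_pM2r // expr2; nra.
have [i iN ile] := binomial_term_ge N (ltW y'0).
pose l := (N - i)%N; have lN : (l + i = N)%N by rewrite subnK.
have block : c ^+ N <= ('C(l + i, i) ^ 2 * num_avoiders (front r) l)%:R.
  have x0 : 0 < N.+1%:R ^+ 2 :> R by rewrite exprn_gt0.
  rewrite -(ler_pM2r x0); apply: le_trans big _; rewrite lN natrM natrX.
  apply: (@le_trans _ _ (kappa * (N.+1%:R * ('C(N, i)%:R * y' ^+ l)) ^+ 2)).
    rewrite ler_pM2l //; apply: lerXn2r ile;
      by rewrite nnegrE ?mulr_ge0 ?exprn_ge0 //; lra.
  have := lowy' l; rewrite exprAC; move: x0.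
  move: ('C(N, i)%:R) (N.+1%:R) ((num_avoiders _ l)%:R) (y' ^+ l) => C x S Y x0 h.
  have -> : kappa * (x * (C * Y)) ^+ 2 = C ^+ 2 * (kappa * Y ^+ 2) * x ^+ 2 by ring.
  by rewrite ler_wpM2r ?(ltW x0) // ler_wpM2l ?sqr_ge0.
have blocks m : c ^+ (N * m) <= (num_avoiders (front (front r)) (m * N + l))%:R.
  have := num_avoiders_front_blocks r l i m k0; rewrite lN -(ler_nat R) natrX.
  apply: le_trans; rewrite exprM; apply: lerXn2r; rewrite ?nnegrE ?exprn_ge0 ?(ltW c0) //.
  by move: block; rewrite lN.
(* This pays for the at most [l + N] positions outside the [m] complete blocks. *)
exists (c ^+ (l + N))^-1; first by rewrite invr_gt0 exprn_gt0.
move=> n; rewrite ler_pdivrMl ?exprn_gt0 //.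
have [m nm mN] : exists2 m, (n <= l + N + N * m)%N & (m * N <= n - l)%N.
  exists ((n - l) %/ N)%N; last exact: leq_divM.
  have := divn_eq (n - l) N; have := ltn_pmod (n - l) N0; rewrite (mulnC N).
  by clear; move: (_ %/ _ * N)%N (_ %% N)%N => u v; lia.
apply: (@le_trans _ _ (c ^+ (l + N + N * m))); first by rewrite ler_weXn2l.
rewrite exprD ler_pM2l ?exprn_gt0 //.
have [ln|nl] := leqP l n.
  apply: le_trans (blocks m) _; rewrite ler_nat; apply: num_avoiders_front_mono; first by [].
  by clear -mN ln; lia.
have -> : m = 0%N by clear -mN nl N0; nia.
rewrite muln0 expr0 ler1n card_gt0; apply/set0Pn; exists (perm (@rev_ord_inj n)).
by rewrite inE avoids_frontW ?decreasing_avoids.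
Qed.

Lemma growth_pattern_q (R : realType) (k : nat) : (4 <= k)%N ->
  growth (num_avoiders (pattern_q k)) (k%:R - 4 + Num.sqrt 8 : R).
Proof.
elim: k => // k IHk; rewrite leq_eqVlt => /orP[/eqP <-|k4].
  by rewrite subrr add0r; exact: growth_1342.
have -> : k.+1%:R - 4 + Num.sqrt 8 = 1 + (k%:R - 4 + Num.sqrt 8) :> R by rewrite -natr1; ring.
case: k k4 IHk => // k k4 /(_ k4); rewrite !pattern_q_front //; last by lia.
apply: growth_front; first by lia.
have : 4 <= k.+1%:R :> R by rewrite ler_nat.
by have : 0 < Num.sqrt 8 :> R by [rewrite sqrtr_gt0]; lra.
Qed.

Lemma powR_exprn_inv (R : realType) (x : R) (n : nat) :
  0 <= x -> (0 < n)%N -> (x ^+ n) `^ n%:R^-1 = x.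
Proof.
move=> x0 n0; rewrite -powR_mulrn // -powRrM mulfV ?powRr1 //.
by rewrite pnatr_eq0 -lt0n.
Qed.

Lemma growth_cvg (R : realType) (k : nat) (q : 'S_k) (y : R) :
  0 < y -> growth (num_avoiders q) y ->
  (avoiders_root R q @ \oo --> (y ^+ 2 : R))%classic.
Proof.
move=> y0 [up low]; set x := y ^+ 2; have x0 : 0 < x by rewrite exprn_gt0.
apply/cvgrPdist_lt => e e0.
(* With this choice [x - 2 d] is positive and within [e] of [x]; the roots are squeezed between
   [x - 2 d] and [x]. *)
pose d := Num.min e x / 4.
have m0 : 0 < Num.min e x by rewrite lt_min e0.
have d0 : 0 < d by rewrite divr_gt0.
have de : 4 * d <= e by rewrite /d mulrC divfK // ge_min lexx.
have dx : 4 * d <= x by rewrite /d mulrC divfK // ge_min lexx orbT.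
have [||kappa kappa0 lowc] := low (x - d); [lra|by rewrite -/x; lra|].
have b0 : 0 < x - 2 * d by lra.
(* The gap between [x - d] and [x - 2 d] absorbs [kappa] as soon as [n >= K / kappa]. *)
have [|K K0 quartic] := @quartic_le_exp R ((x - d) / (x - 2 * d)).
  by rewrite ltr_pdivlMr // mul1r; lra.
near=> n.
have n0 : (0 < n)%N by near: n; exists 1%N.
have nK : K / kappa <= n%:R by near: n; exact: nbhs_infty_ger.
have rootle (u v : R) : 0 <= u -> u <= v -> u `^ n%:R^-1 <= v `^ n%:R^-1.
  by move=> u0 uv; apply: ge0_ler_powR; rewrite ?nnegrE ?invr_ge0 //; lra.
have upn : avoiders_root R q n <= x.
  rewrite /avoiders_root -[leRHS](@powR_exprn_inv _ _ n) ?(ltW x0) //.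
  exact: rootle.
have lown : x - 2 * d <= avoiders_root R q n.
  rewrite /avoiders_root -[leLHS](@powR_exprn_inv _ _ n) ?(ltW b0) //.
  apply: rootle; first by rewrite exprn_ge0 // ltW.
  apply: le_trans (lowc n).
  have := quartic n; rewrite expr_div_n mulrA ler_pdivlMr ?exprn_gt0 // => q4.
  have Kk : K <= kappa * n%:R by rewrite mulrC -ler_pdivrMr.
  have n1 : 1 <= n%:R :> R by rewrite ler1n.
  move: q4; rewrite -natr1; move: (n%:R) Kk n1 => t Kk t1.
  have := exprn_gt0 n b0; move: ((x - 2 * d) ^+ n) => f f0.
  have : 0 < (x - d) ^+ n by rewrite exprn_gt0 //; lra.
  move: ((x - d) ^+ n) => g g0 q4.
  have t0 : 0 < t by lra.
  rewrite -(ler_pM2l t0); apply: (@le_trans _ _ (K * g)); last first.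
    by rewrite [leRHS]mulrA [t * _]mulrC ler_pM2r.
  apply: le_trans q4; rewrite ler_pM2r //.
  have : 1 <= (t + 1) ^+ 3 by rewrite exprn_ege1 //; lra.
  by rewrite (exprS _ 3); nra.
by rewrite ger0_norm ?subr_ge0 //; lra.
Unshelve. all: by end_near. Qed.

Theorem theorem5p2 (R : realType) (k : nat) (hk : (4 <= k)%N) :
  cvgn (avoiders_root R (pattern_q k)) /\
  growth_rate R (pattern_q k) = (k%:R - 4 + Num.sqrt 8) ^+ 2.
Proof.
have y0 : 0 < k%:R - 4 + Num.sqrt 8 :> R.
  have : 4 <= k%:R :> R by rewrite ler_nat.
  by have : 0 < Num.sqrt 8 :> R by [rewrite sqrtr_gt0]; lra.
have cvg := growth_cvg y0 (growth_pattern_q R hk).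
by split; [apply/cvg_ex; exists ((k%:R - 4 + Num.sqrt 8) ^+ 2)|exact/cvg_lim].
Qed.
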